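(* Let $G$ be a finite group and assume that $K$ contains a primitive $|G|$-th root of unity. For any $\chi\in\mathbb{Z}\mathrm{Irr}(G)$ we have $$c(\chi)_p = c\left(\{d^u_{\chi,\varphi}\ |\ u\in G_p\ \text{and}\ \varphi\in\mathrm{IBr}(C_G(u))\}\right).$$
   Context: Let $p$ be a prime, $\mathcal{O}$ a complete discrete valuation ring with residue field $k$ of characteristic $p$ and field of fractions $K$ of characteristic $0$. For a positive integer $n$, $\zeta_n$ denotes a primitive $n$-th root of unity in an extension field of $K$. For a finite group $G$, $\mathrm{Irr}(G)$ is the set of $K$-valued irreducible characters, $\mathrm{IBr}(G)$ the set of $K$-valued irreducible ($p$-)Brauer characters, $\mathbb{Z}\mathrm{Irr}(G)$ the group of generalised characters, and $G_p$, $G_{p'}$ are the sets of elements of order a power of $p$, respectively of order prime to $p$. For $\chi\in\mathbb{Z}\mathrm{Irr}(G)$, $u\in G_p$ and $\varphi\in\mathrm{IBr}(C_G(u))$, the generalised decomposition numbers $d^u_{\chi,\varphi}$ are the unique cyclotomic integers (Brauer) such that $\chi(us)=\sum_{\varphi\in\mathrm{IBr}(C_G(u))} d^u_{\chi,\varphi}\,\varphi(s)$ for all $s\in C_G(u)_{p'}$; they lie in $\mathbb{Q}(\eta)$ for some root of unity $\eta$ of $p$-power order dividing the order of $u$. For a set $S$ of cyclotomic integers, $c(S)$ is the smallest positive integer $n$ with $S\subseteq\mathbb{Q}(\zeta_n)$. For $\chi\in\mathbb{Z}\mathrm{Irr}(G)$ the conductor is $c(\chi)=c(\{\chi(g)\mid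 g\in G\})$, and $c(\chi)_p$ is the highest power of $p$ dividing $c(\chi)$. *)

(* Defs.v *)
From HB Require Import structures.
From mathcomp Require Export all_boot all_order all_algebra all_fingroup
  all_solvable mxrepresentation.
From mathcomp Require Export boolp classical_sets functions cardinality fsbigop.

Set Implicit Arguments.
Unset Strict Implicit.
Unset Printing Implicit Defensive.

Import GroupScope GRing.Theory.
Local Open Scope classical_set_scope.
Local Open Scope ring_scope.

Definition adic_dvd (O : idomainType) (t : O) (n : nat) (x : O) : Prop :=
  exists c : O, x = c * t ^+ n.

Definition uniformizer (O : idomainType) (t : O) : Prop :=
  [/\ t != 0, t \isn't a GRing.unit
    & forall x : O, x != 0 ->
        exists n : nat, exists2 c : O, c \is a GRing.unit & x = c * t ^+ n].

Definition adic_complete (O : idomainType) (t : O) : Prop :=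
  forall x : nat -> O,
    (forall n, exists m, forall i j, (m <= i)%N -> (m <= j)%N ->
       adic_dvd t n (x i - x j)) ->
    exists l : O, forall n, exists m, forall i, (m <= i)%N ->
      adic_dvd t n (x i - l).

Definition complete_dvr (O : idomainType) : Prop :=
  exists2 t : O, uniformizer t & adic_complete t.

Record pmodular_system (p : nat) (O : idomainType) (K k : fieldType)
    (frac : {rmorphism O -> K}) (res : {rmorphism O -> k}) : Prop := {
  pmod_dvr : complete_dvr O;
  pmod_frac_inj : injective frac;
  pmod_frac_quot : forall x : K,
    exists a : O, exists2 b : O, b != 0 & x = frac a / frac b;
  pmod_res_surj : forall y : k, exists x : O, res x = y;
  pmod_res_ker : forall x : O, (res x == 0) = (x \isn't a GRing.unit);
  pmod_char_frac : [pchar K] =i pred0;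
  pmod_char_res : p \in [pchar k]
}.

Section Characters.

Variables (K : fieldType) (gT : finGroupType).

(* Characters of G, like the class functions of the library, are functions on
   the whole ambient type gT that are extended by 0 outside G. *)
Definition char_of_repr (G : {group gT}) n (rG : mx_representation K G n) :
    {ffun gT -> K} :=
  [ffun g => if g \in G then \tr (rG g) else 0].

Definition Irr (G : {group gT}) : set {ffun gT -> K} :=
  [set chi | exists n (rG : mx_representation K G n),
     mx_irreducible rG /\ chi = char_of_repr rG].

Definition ZIrr (G : {group gT}) : set {ffun gT -> K} :=
  [set chi | exists a : {ffun gT -> K} -> int,
     chi = \sum_(psi \in Irr G) psi *~ a psi].

End Characters.

Section BrauerCharacters.

Variables (p : nat) (O : idomainType) (K k : fieldType).
Variables (frac : {rmorphism O -> K}) (res : {rmorphism O -> k}).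
Variable gT : finGroupType.

(* The roots of the characteristic polynomial of A are lifted, with their
   multiplicities, to m-th roots of unity in O. When p does not divide m, the
   reduction is injective on these, so the lifts are unique. *)
Definition brauer_lift (m n : nat) (A : 'M[k]_n) (x : K) : Prop :=
  exists zs : seq O,
    [/\ forall z, z \in zs -> z ^+ m = 1,
        char_poly A = \prod_(z <- zs) ('X - (res z)%:P)
      & x = \sum_(z <- zs) frac z].

(* Brauer characters are extended by 0 outside the p-regular elements of G. *)
Definition is_brauer_char (G : {group gT}) n (rG : mx_representation k G n)
    (phi : {ffun gT -> K}) : Prop :=
  forall g : gT,
    if (g \in G) && p^'.-elt g then brauer_lift #[g] (rG g) (phi g)
    else phi g = 0.

Definition IBr (G : {group gT}) : set {ffun gT -> K} :=
  [set phi | exists n (rG : mx_representation k G n),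
     mx_irreducible rG /\ is_brauer_char rG phi].

Definition gen_decomposition (G : {group gT}) (chi : {ffun gT -> K}) (u : gT) :
    set ({ffun gT -> K} -> K) :=
  [set d | forall s, s \in 'C_G[u] -> p^'.-elt s ->
     chi (u * s)%g = \sum_(phi \in IBr 'C_G[u]) d phi * phi s].

(* The coefficients at phi in IBr 'C_G[u] are determined by the defining
   equations; those at other phi are meaningless. *)
Definition gen_decomp_num (G : {group gT}) (chi : {ffun gT -> K}) (u : gT) :
    {ffun gT -> K} -> K :=
  xget (fun=> 0) (gen_decomposition G chi u).

Definition gen_decomp_nums (G : {group gT}) (chi : {ffun gT -> K}) : set K :=
  [set x | exists u phi, [/\ u \in G, p.-elt u, IBr 'C_G[u] phi
                           & x = gen_decomp_num G chi u phi]].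

End BrauerCharacters.

Section Conductors.

Variable K : fieldType.

(* S is contained in Q(zeta_n), the root of unity being taken in an extension
   field L of K. As zeta_n is algebraic, Q(zeta_n) = Q[zeta_n]. *)
Definition sub_cyclotomic (n : nat) (S : set K) : Prop :=
  exists (L : fieldType) (j : {rmorphism K -> L}) (zeta : L),
    n.-primitive_root zeta /\
    forall x, S x -> exists q : {poly rat}, j x = (map_poly ratr q).[zeta].

Definition conductor (S : set K) : nat :=
  xget 0%N [set n | [/\ (0 < n)%N, sub_cyclotomic n S
    & forall m, (0 < m)%N -> sub_cyclotomic m S -> (n <= m)%N]].

Definition char_conductor (gT : finGroupType) (G : {group gT})
    (chi : {ffun gT -> K}) : nat :=
  conductor [set x | exists2 g, g \in G & x = chi g].

End Conductors.

(* Main.v *)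
Require Import Defs.
From HB Require Import structures.
From mathcomp Require Import all_field integral_char.
Import GroupScope GRing.Theory.
Local Open Scope ring_scope.
Set Implicit Arguments.
Unset Strict Implicit.
Unset Printing Implicit Defensive.

(** Write N = |G| and let w be a primitive N-th root of unity in K.  For a
    coprime to N let sigma_a be the automorphism of Q(w) that maps w to w^a.

    Galois theory.  If a subset S of Q(w) lies in Q(zeta_n), with zeta_n in some
    extension of K, then every sigma_a with a = 1 modulo gcd(n, N) fixes S
    (sub_cyc_fixed); conversely, if n divides N and every sigma_a with a = 1
    modulo n fixes S, then S lies in Q(w^(N/n)) (cyc_fixed_sub).  Hence c(S) is
    the least divisor n of N such that the sigma_a with a = 1 modulo n fix S
    (conductor_cyc_fixed).  By the Chinese remainder theorem, if the set T lies
    in Q(w^(N_p')), a field generated by a root of unity of p-power order, and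
    if the sigma_a with a = 1 modulo N_p' that fix S are those that fix T, then
    c(S)_p = c(T) (conductor_p_part).

    This is applied to the set S of values of chi and the set T of generalised
    decomposition numbers.  For a = 1 modulo N_p' the map sigma_a fixes the
    values of all Brauer characters, so applying it to
      chi(u s) = sum_phi d^u_(chi, phi) phi(s)
    shows that chi(u s) is fixed for all s if and only if all the
    d^u_(chi, phi) are, provided that the Brauer characters of C_G(u) are
    linearly independent.  So two facts on a subgroup C of G remain.

    Existence.  For a K-representation of C and a matrix A of finite order
    commuting with it, s |-> tr(s A) is a combination of IBr(C) on p-regular
    elements, with coefficients in the ring generated by the eigenvalues of A
    (p_regular_trace_twist): the eigenspaces of A reduce the claim to A = 1,
    where one chooses an integral form, reduces it modulo the maximal ideal,
    and takes the composition factors (p_regular_trace).  With C = C_G(u) and A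
    the action of u this gives decomposition numbers in Q(w^(N_p')).

    Independence.  Let l be the number of p-regular classes of C.  On the one
    hand |IBr(C)| <= l: pairwise nonisomorphic irreducible k-representations
    have irreducible quotients over a splitting field whose traces are linearly
    independent, while such a trace only depends on the p-regular part of its
    argument (card_irr_p_regular_classes).  On the other hand, for s a
    p-regular element, taking for A the left translation by s^-1 on the regular
    representation shows that IBr(C) spans, on p-regular elements, a nonzero
    multiple of the indicator function of the class of s (class_separation).
    So the matrix of values of IBr(C) on representatives of the l classes has
    rank l and at most l rows, which are therefore independent (IBr_free). *)

(** * Rational polynomials evaluated at roots of unity *)

(** In any field of characteristic 0 the map ratr is a ring morphism. *)
Section RatrMorphism.

Variable L : fieldType.
Hypothesis L0 : [pchar L] =i pred0.

Lemma intr_eq0_pchar0 (i : int) : (i%:~R == 0 :> L) = (i == 0).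
Proof.
have nat_eq0 n : (n%:R == 0 :> L) = (n == 0)%N by apply/(pcharf0P L).1.
by case: i => n; rewrite ?NegzE ?rmorphN ?oppr_eq0 -?pmulrn ?nat_eq0.
Qed.

Lemma denq_neq0_pchar0 x : (denq x)%:~R != 0 :> L.
Proof. by rewrite intr_eq0_pchar0 denq_eq0. Qed.

Lemma ratr_zmod_morphism_pchar0 : zmod_morphism (@ratr L).
Proof.
have injZtoQ: @injective rat int intr by apply: intr_inj.
have nz_den := denq_neq0_pchar0.
move=> x y.
apply: (canLR (mulfK (nz_den _))); apply: (mulIf (nz_den x)).
rewrite mulrAC mulrBl divfK ?nz_den // mulrAC -!rmorphM.
apply: (mulIf (nz_den y)); rewrite mulrAC mulrBl divfK ?nz_den //.
rewrite -!(rmorphM, rmorphB); congr _%:~R; apply: injZtoQ.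
rewrite !(rmorphM, rmorphB) /= [_ - _]lock /= -lock !numqE.
by rewrite (mulrAC y) -!mulrBl -mulrA mulrAC !mulrA.
Qed.

Lemma ratr_monoid_morphism_pchar0 : monoid_morphism (@ratr L).
Proof.
have injZtoQ: @injective rat int intr by apply: intr_inj.
have nz_den := denq_neq0_pchar0.
split=> [|x y]; first by rewrite /ratr divr1.
rewrite /ratr mulrC mulrAC; apply: canLR (mulKf (nz_den _)) _; rewrite !mulrA.
do 2!apply: canRL (mulfK (nz_den _)) _; rewrite -!rmorphM; congr _%:~R.
apply: injZtoQ; rewrite !rmorphM [x * y]lock /= !numqE -lock.
by rewrite -!mulrA mulrA mulrCA -!mulrA (mulrCA y).
Qed.

Definition ratr_pchar0 : {rmorphism rat -> L} :=
  HB.pack (@ratr L)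
    (GRing.isZmodMorphism.Build _ _ _ ratr_zmod_morphism_pchar0)
    (GRing.isMonoidMorphism.Build _ _ _ ratr_monoid_morphism_pchar0).

End RatrMorphism.

(** The value f(z) of a rational polynomial at z. *)
Definition qeval (L : fieldType) (z : L) (f : {poly rat}) : L :=
  (map_poly ratr f).[z].

Section QEval.

Variable L : fieldType.
Hypothesis L0 : [pchar L] =i pred0.
Implicit Types (z : L) (f g : {poly rat}).

Lemma qevalE z f : qeval z f = (map_poly (ratr_pchar0 L0) f).[z].
Proof. by []. Qed.

Lemma qevalD z f g : qeval z (f + g) = qeval z f + qeval z g.
Proof. by rewrite !qevalE rmorphD hornerD. Qed.
Lemma qevalB z f g : qeval z (f - g) = qeval z f - qeval z g.
Proof. by rewrite !qevalE rmorphB hornerD hornerN. Qed.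
Lemma qevalM z f g : qeval z (f * g) = qeval z f * qeval z g.
Proof. by rewrite !qevalE rmorphM hornerM. Qed.
Lemma qeval0 z : qeval z 0 = 0.
Proof. by rewrite qevalE rmorph0 horner0. Qed.
Lemma qeval1 z : qeval z 1 = 1.
Proof. by rewrite qevalE rmorph1 hornerC. Qed.
Lemma qevalXn z n : qeval z 'X^n = z ^+ n.
Proof. by rewrite qevalE map_polyXn hornerXn. Qed.
Lemma qevalXnM z n f : qeval z (f \Po 'X^n) = qeval (z ^+ n) f.
Proof. by rewrite !qevalE map_comp_poly map_polyXn horner_comp hornerXn. Qed.

Lemma rmorph_qeval (L' : fieldType) (j : {rmorphism L -> L'}) z f :
  j (qeval z f) = qeval (j z) f.
Proof.
rewrite /qeval -horner_map /= -map_poly_comp; congr _.[_].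
by apply: eq_map_poly => x /=; rewrite /ratr fmorph_div !rmorph_int.
Qed.

End QEval.

Section Cyclotomic.

Notation ZtoQ := (intr : int -> rat).
Notation CycQ n := (map_poly ZtoQ 'Phi_n).

Lemma Cyclotomic_minimal n (z : algC) (f : {poly rat}) :
  n.-primitive_root z -> root (map_poly ratr f) z = (CycQ n %| f).
Proof.
move=> prim_z; have [pf [Dpf mon_pf] dv_pf] := minCpolyP z.
rewrite dv_pf; congr (_ %| _).
apply: (map_poly_inj (@ratr algC)); rewrite /= -Dpf (minCpoly_cyclotomic prim_z).
rewrite -(Cintr_Cyclotomic prim_z) -map_poly_comp.
by apply: eq_map_poly => a; rewrite /= ratr_int.
Qed.

Lemma root_Cyclotomic (L : fieldType) n (z : L) :
  n.-primitive_root z -> root (map_poly intr 'Phi_n) z.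
Proof.
move=> prim_z; have n_gt0 := prim_order_gt0 prim_z.
have: root (map_poly intr (\prod_(d <- divisors n) 'Phi_d)) z.
  rewrite prod_Cyclotomic // rmorphB /= map_polyXn rmorph1 rootE !hornerE.
  by rewrite (prim_expr_order prim_z) subrr.
rewrite rmorph_prod /root horner_prod prodf_seq_eq0 => /hasP[d].
rewrite -dvdn_divisors //= => d_dv_n zd0; suff <- : d = n by [].
apply/eqP; rewrite eqn_dvd d_dv_n (prim_order_dvd prim_z) -subr_eq0.
have d_gt0 := dvdn_gt0 n_gt0 d_dv_n.
have: (map_poly intr ('X^d - 1 : {poly int})).[z] == 0.
  rewrite -prod_Cyclotomic // (big_rem d) -?dvdn_divisors //=.
  by rewrite rmorphM hornerM (eqP zd0) mul0r.
by rewrite rmorphB /= map_polyXn rmorph1 !hornerE.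
Qed.

Lemma qeval_prim_root (L : fieldType) n (z : L) (f : {poly rat}) :
    [pchar L] =i pred0 -> n.-primitive_root z ->
  (qeval z f == 0) = (CycQ n %| f).
Proof.
move=> L0 prim_z; have n_gt0 := prim_order_gt0 prim_z.
have z0 : qeval z (CycQ n) = 0.
  rewrite (qevalE L0) -map_poly_comp; apply/eqP; rewrite -[_ == _]/(root _ z).
  rewrite (eq_map_poly (_ : _ =1 intr)) ?root_Cyclotomic // => a.
  by rewrite /= ratr_int.
apply/idP/idP=> [fz0 | /dvdpP[q ->]]; last by rewrite qevalM // z0 mulr0.
have Cf : ~~ coprimep (CycQ n) f.
  apply/negP=> /Bezout_eq1_coprimepP[[u v] /= uv1].
  have := qeval1 L0 z; rewrite -uv1 qevalD // !qevalM // z0 (eqP fz0).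
  by rewrite !mulr0 addr0 => /eqP; rewrite eq_sym oner_eq0.
set g := gcdp (CycQ n) f in Cf *; apply: dvdp_trans (dvdp_gcdr (CycQ n) f).
have CycN0 : CycQ n != 0.
  by rewrite monic_neq0 // monic_map // Cyclotomic_monic.
have [x xg0] : exists x : algC, root (map_poly ratr g) x.
  by apply/closed_rootP; rewrite size_map_poly; apply: Cf.
have [z1 prim_z1] := C_prim_root_exists n_gt0.
rewrite -(Cyclotomic_minimal (z := x)) //.
have : root (map_poly (ratr : rat -> algC) (CycQ n)) x.
  by have /dvdpP[q ->] := dvdp_gcdl (CycQ n) f; rewrite rmorphM rootM xg0 orbT.
rewrite -map_poly_comp (eq_map_poly (_ : _ =1 intr)); last first.
  by move=> a; rewrite /= ratr_int.
by rewrite (Cintr_Cyclotomic prim_z1) root_cyclotomic.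
Qed.

(** The relations over Q satisfied by a primitive n-th root of unity do not
    depend on the root, nor on the field of characteristic 0 containing it. *)
Lemma qeval_transfer (L L' : fieldType) n (z : L) (z' : L') (f : {poly rat}) :
    [pchar L] =i pred0 -> [pchar L'] =i pred0 ->
    n.-primitive_root z -> n.-primitive_root z' ->
  (qeval z f == 0) = (qeval z' f == 0).
Proof. by move=> L0 L'0 pz pz'; rewrite !(qeval_prim_root (n := n)). Qed.

End Cyclotomic.

(** * Subfields generated by roots of unity *)

(** The moduli n and N need not be coprime. *)
Lemma chinese_unit_lift a n N :
    (0 < n)%N -> coprime a N -> a = 1 %[mod gcdn n N] ->
  exists b, [/\ b = a %[mod N], b = 1 %[mod n] & coprime b (N * n)].
Proof.
move=> n_gt0 coaN a1.
suff [b ba b1]: exists2 b, b = a %[mod N] & b = 1 %[mod n].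
  exists b; split=> //; rewrite coprimeMr -coprime_modl ba coprime_modl coaN.
  by rewrite -coprime_modl b1 coprime_modl coprime1n.
case: a coaN a1 => [|a] coaN a1.
  by move: coaN; rewrite /coprime gcd0n => /eqP->; exists 1; rewrite ?modn1.
have [c Dc]: exists c, a = (c * gcdn n N)%N.
  apply/dvdnP; rewrite /dvdn -(mod0n (gcdn n N)).
  by rewrite -(eqn_modDl 1) addn0 add1n; apply/eqP.
have [t _ /dvdnP[q Dq]] := Bezoutl N n_gt0.
exists (a.+1 + c * (t * N))%N; first by rewrite mulnA addnC modnMDl.
by rewrite Dc -addn1 addnAC -mulnDr Dq mulnA modnMDl.
Qed.

Section PrimRootProduct.

Variable L : fieldType.

Lemma prim_root_mul_coprime m n (x y : L) :
  m.-primitive_root x -> n.-primitive_root y -> coprime m n ->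
  (m * n).-primitive_root (x * y).
Proof.
have dvd_order m' n' (x' y' : L) d : m'.-primitive_root x' ->
    n'.-primitive_root y' -> coprime m' n' -> (x' * y') ^+ d = 1 -> (m' %| d)%N.
  move=> px py co /(congr1 (fun t => t ^+ n')).
  rewrite exprMn expr1n exprMn -!exprM [in y' ^+ _]mulnC [y' ^+ _]exprM.
  rewrite (prim_expr_order py) expr1n mulr1 => /eqP.
  by rewrite -(prim_order_dvd px) Gauss_dvdl.
move=> px py co; have mn_gt0: (0 < m * n)%N.
  by rewrite muln_gt0 (prim_order_gt0 px) (prim_order_gt0 py).
have xy1: (x * y) ^+ (m * n) = 1.
  rewrite exprMn [in y ^+ _]mulnC !exprM (prim_expr_order px).
  by rewrite (prim_expr_order py) !expr1n mulr1.
have [d pd d_dv] := prim_order_exists mn_gt0 xy1.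
suff /eqP <-: d == (m * n)%N by [].
have xyd := prim_expr_order pd; rewrite eqn_dvd d_dv Gauss_dvd //=.
rewrite (dvd_order _ _ _ _ _ px py) //= (dvd_order _ _ _ _ _ py px) //.
  by rewrite coprime_sym.
by rewrite mulrC.
Qed.

(** Two roots of unity are powers of a single one, whose order M is the least
    common multiple of their orders; the factors of M are distributed according
    to which of N and n has the larger q-part. *)
Lemma prim_root_join N n (w z : L) :
    N.-primitive_root w -> n.-primitive_root z ->
  exists M (e : L) i k,
    [/\ M.-primitive_root e, (M %| N * n)%N, w = e ^+ i & z = e ^+ k].
Proof.
move=> pw pz; have N_gt0 := prim_order_gt0 pw; have n_gt0 := prim_order_gt0 pz.
pose pi := [pred q | (logn q n <= logn q N)%N]; pose M := (N`_pi * n`_pi^')%N.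
have pM: M.-primitive_root (w ^+ (N %/ N`_pi) * z ^+ (n %/ n`_pi^')).
  apply: prim_root_mul_coprime; try by rewrite dvdn_prim_root ?dvdn_part.
  exact: pnat_coprime (part_pnat _ _) (part_pnat _ _).
have sub_part (rho : nat_pred) q m : q \in rho -> (m`_q %| m`_rho)%N.
  by move=> q_rho; apply: sub_in_partn => r _ /eqP->.
have N_dv: (N %| M)%N.
  apply/(dvdn_partP _ N_gt0) => q _; have [q_pi|q'pi] := boolP (q \in pi).
    by rewrite dvdn_mulr ?sub_part.
  apply/dvdn_mull/(@dvdn_trans n`_q); last exact: sub_part.
  by rewrite !p_part dvdn_exp2l //; rewrite inE -ltnNge in q'pi; apply: ltnW.
have n_dv: (n %| M)%N.
  apply/(dvdn_partP _ n_gt0) => q _; have [q_pi|q'pi] := boolP (q \in pi).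
    apply/dvdn_mulr/(@dvdn_trans N`_q); last exact: sub_part.
    by rewrite !p_part dvdn_exp2l.
  by rewrite dvdn_mull ?sub_part.
have wM: w ^+ M = 1 by apply/eqP; rewrite -(prim_order_dvd pw).
have zM: z ^+ M = 1 by apply/eqP; rewrite -(prim_order_dvd pz).
have [i Dw] := prim_rootP pM wM; have [k Dz] := prim_rootP pM zM.
exists M; eexists; exists i, k; split; [exact: pM| | exact: Dw | exact: Dz].
by rewrite dvdn_mul ?dvdn_part.
Qed.

End PrimRootProduct.

Section Conjugation.

Variables (K : fieldType) (N : nat) (w : K).
Hypotheses (K0 : [pchar K] =i pred0) (pw : N.-primitive_root w).

(** Membership in Q(w) = Q[w]. *)
Definition inQw (x : K) : Prop := exists f, x = qeval w f.

(** The automorphism of Q(w) that maps w to w^a, for a coprime to the order of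
    w: a rational polynomial representing x at w is evaluated at w^a.  The
    value is meaningless outside Q(w). *)
Definition cyc_conj (a : nat) (x : K) : K :=
  qeval (w ^+ a) (xget 0 [set f | x = qeval w f]%classic).

Lemma cyc_conjE a f : coprime a N -> cyc_conj a (qeval w f) = qeval (w ^+ a) f.
Proof.
move=> coaN; rewrite /cyc_conj; set g := xget _ _.
have Dg: qeval w f = qeval w g.
  by apply: (@xgetPex _ 0 [set g | qeval w f = qeval w g]%classic); exists f.
apply/eqP; rewrite -subr_eq0 -qevalB // (qeval_transfer (n := N) (z' := w)) //.
  by rewrite qevalB // Dg subrr.
by rewrite prim_root_exp_coprime.
Qed.

(** S is fixed by every w |-> w^a with a = 1 modulo n; for n dividing N these
    form the Galois group of Q(w) over Q(w^(N/n)). *)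
Definition cyc_fixed (n : nat) (S : set K) : Prop :=
  forall a, coprime a N -> a = 1 %[mod n] -> forall x, S x -> cyc_conj a x = x.

(** The Galois correspondence is applied in an abstract number field generated
    by a primitive N-th root of unity and carried over to K. *)
Lemma cyc_fixed_sub n (S : set K) :
    (forall x, S x -> inQw x) -> (n %| N)%N -> cyc_fixed n S ->
  sub_cyclotomic n S.
Proof.
move=> SQ n_dv fixS; have N_gt0 := prim_order_gt0 pw.
exists K, idfun, (w ^+ (N %/ n)); split=> [|x Sx]; first exact: dvdn_prim_root.
have [f Dx] := SQ x Sx; have {fixS Sx}fixx a coaN a1 := fixS a coaN a1 x Sx.
have [Qn galQn [QnC _ [e []]]] := group_num_field_exists (Zp_group N).
rewrite card_Zp // => pe _ _.
have Qn0 : [pchar Qn] =i pred0.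
  by move=> q; rewrite -(fmorph_pchar QnC) Num.Theory.pchar_num.
pose z := e ^+ (N %/ n); have pz: n.-primitive_root z by apply: dvdn_prim_root.
pose E := <<1; z>>%AS.
have galE: galois E {:Qn} by apply: galoisS galQn; rewrite sub1v subvf.
have Ex: qeval e f \in E.
  rewrite -(galois_fixedField galE); apply/fixedFieldP=> [|s Gs]; rewrite ?memvf //.
  rewrite rmorph_qeval.
  have [a Da] := prim_rootP pe (etrans (esym (rmorphXn s N e))
     (etrans (congr1 s (prim_expr_order pe)) (rmorph1 s))).
  have coaN: coprime a N.
    by rewrite -(prim_root_exp_coprime _ pe) -Da fmorph_primitive_root.
  have a1: a = 1 %[mod n].
    apply/eqP; rewrite -(eq_prim_root_expr pz) expr1 -exprM mulnC exprM -Da.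
    rewrite -rmorphXn /= (fixed_gal _ Gs) ?sub1v ?subvf //.
    exact: memv_adjoin.
  rewrite Da; apply/eqP; rewrite -subr_eq0 -qevalXnM // -qevalB //.
  rewrite (qeval_transfer _ Qn0 K0 pe pw) qevalB // qevalXnM // -cyc_conjE //.
  by rewrite -Dx fixx // Dx subrr.
have /Fadjoin_polyP[q /polyOver1P[h ->] Dh] := Ex.
exists h; rewrite Dx; apply/eqP; rewrite -[_.[_]]/(qeval _ h) /= -subr_eq0.
rewrite -qevalXnM // -qevalB // -(qeval_transfer _ Qn0 K0 pe pw) qevalB //.
rewrite qevalXnM // Dh subr_eq0; apply/eqP; congr _.[_].
by apply: eq_map_poly => a; rewrite -[in RHS](fmorph_eq_rat (in_alg Qn)).
Qed.

Lemma sub_cyc_fixed n (S : set K) :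
    (forall x, S x -> inQw x) -> (0 < n)%N -> sub_cyclotomic n S ->
  cyc_fixed (gcdn n N) S.
Proof.
move=> SQ n_gt0 [L [j [z [pz Sz]]]] a coaN a1 x Sx.
have [f Dx] := SQ x Sx; have [h Dh] := Sz x Sx.
have L0 : [pchar L] =i pred0 by move=> q; rewrite (fmorph_pchar j) K0.
have pjw: N.-primitive_root (j w) by rewrite fmorph_primitive_root.
have [M [e [i [k [pe MNn Dw Dz]]]]] := prim_root_join pjw pz.
have [b [ba b1 cob]] := chinese_unit_lift n_gt0 coaN a1.
have coaM: coprime b M by apply: coprime_dvdr MNn cob.
have wab: w ^+ a = w ^+ b by apply/eqP; rewrite (eq_prim_root_expr pw) ba.
have zb: z ^+ b = z by rewrite -[RHS]expr1; apply/eqP; rewrite (eq_prim_root_expr pz) b1.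
have /eqP := Dh; rewrite Dx rmorph_qeval // Dw Dz -[_.[_]]/(qeval _ h).
rewrite -subr_eq0 -!qevalXnM // -qevalB //.
have peb: M.-primitive_root (e ^+ b) by rewrite prim_root_exp_coprime.
rewrite (qeval_transfer _ L0 L0 pe peb) qevalB // !qevalXnM // -!exprM !(mulnC b).
rewrite !exprM -Dw -Dz zb subr_eq0 => /eqP jx.
rewrite cyc_conjE // -Dx; apply: (fmorph_inj j).
by rewrite rmorph_qeval // rmorphXn /= -rmorphXn wab rmorphXn /= jx Dh.
Qed.

End Conjugation.

(** * The p-part of a conductor *)

Lemma eqmodW d m x y : (d %| m)%N -> x = y %[mod m] -> x = y %[mod d].
Proof. by move=> d_m xy; rewrite -(modn_dvdm x d_m) xy modn_dvdm. Qed.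

Section ConductorPart.

Variables (K : fieldType) (N : nat) (w : K).
Hypotheses (K0 : [pchar K] =i pred0) (pw : N.-primitive_root w).

Local Notation conj := (cyc_conj w).

(** In particular the defining minimum of the conductor is attained, and it
    suffices to look at divisors of N. *)
Lemma conductor_cyc_fixed (S : set K) :
    (forall x, S x -> inQw w x) ->
  [/\ (conductor S %| N)%N, cyc_fixed N w (conductor S) S
    & forall m, (m %| N)%N -> cyc_fixed N w m S -> (conductor S <= m)%N].
Proof.
move=> SQ; have N_gt0 := prim_order_gt0 pw.
have fixN: sub_cyclotomic N S.
  apply: (cyc_fixed_sub K0 pw) => // a coaN aN x Sx.
  have [f ->] := SQ x Sx; rewrite (cyc_conjE K0 pw) //; congr qeval.
  by apply/eqP; rewrite -[X in _ == X]expr1 (eq_prim_root_expr pw) aN.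
pose ok n := `[< (0 < n)%N /\ sub_cyclotomic n S >].
have ex_ok: exists n, ok n by exists N; apply/asboolP.
case: (ex_minnP ex_ok) => n /asboolP[n_gt0 subn] minn.
have [n_gt0' subn' minn'] : [set n | [/\ (0 < n)%N, sub_cyclotomic n S
    & forall m, (0 < m)%N -> sub_cyclotomic m S -> (n <= m)%N]]%classic
    (conductor S).
  apply: (@xgetPex _ 0%N); exists n; split=> // m m_gt0 subm.
  by apply: minn; apply/asboolP.
have fixg := sub_cyc_fixed K0 pw SQ n_gt0' subn'.
have Dg: gcdn (conductor S) N = conductor S.
  apply/eqP; rewrite eqn_leq dvdn_leq ?dvdn_gcdl //=; apply: minn'.
    by rewrite gcdn_gt0 n_gt0'.
  by apply: (cyc_fixed_sub K0 pw) => //; apply: dvdn_gcdr.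
split=> [||m m_dv fixm]; first by rewrite -Dg dvdn_gcdr.
  by rewrite -Dg.
by apply: minn'; [apply: dvdn_gt0 m_dv | apply: (cyc_fixed_sub K0 pw)].
Qed.

Lemma cyc_conjM a b x : coprime a N -> coprime b N -> inQw w x ->
  conj a x = x -> conj (a * b) x = conj b x.
Proof.
move=> coa cob [f ->]; rewrite !(cyc_conjE K0 pw) ?coprimeMl ?coa // => fa.
apply/eqP; rewrite mulnC exprM -subr_eq0 -qevalXnM // -qevalB //.
have pwb: N.-primitive_root (w ^+ b) by rewrite prim_root_exp_coprime.
rewrite -(qeval_transfer _ K0 K0 pw pwb) qevalB // qevalXnM //.
by rewrite fa subrr.
Qed.

Lemma eq_cyc_conj a b x : coprime a N -> a = b %[mod N] -> inQw w x ->
  conj a x = conj b x.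
Proof.
move=> coa ab [f ->].
have cob: coprime b N by rewrite -coprime_modl -ab coprime_modl.
rewrite !(cyc_conjE K0 pw) //; congr qeval.
by apply/eqP; rewrite (eq_prim_root_expr pw) ab.
Qed.

Lemma conductor_p_part p (S T : set K) :
    (forall x, S x -> inQw w x) ->
    (forall x, T x -> inQw (w ^+ N`_p^') x) ->
    (forall a, coprime a N -> a = 1 %[mod N`_p^'] ->
       (forall x, S x -> conj a x = x) <-> (forall x, T x -> conj a x = x)) ->
  ((conductor S)`_p)%N = conductor T.
Proof.
move=> SQ TQP fixST; have N_gt0 := prim_order_gt0 pw.
set P := (N`_p)%N; set m' := (N`_p^')%N in TQP fixST.
have DN: (P * m' = N)%N by apply: partnC.
have coPm: coprime P m' by apply: coprime_partC.
have TQ x : T x -> inQw w x.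
  by case/TQP=> f ->; exists (f \Po 'X^m'); rewrite qevalXnM.
have conjT a b x : coprime a N -> coprime b N -> a = b %[mod P] -> T x ->
    conj a x = conj b x.
  move=> coa cob ab /TQP[f ->]; rewrite -qevalXnM // !(cyc_conjE K0 pw) //.
  rewrite !qevalXnM // -!exprM ![(_ * m')%N]mulnC !exprM; congr qeval.
  apply/eqP; rewrite (@eq_prim_root_expr _ P) ?ab //.
  rewrite -[m'](_ : N %/ P = _)%N ?dvdn_prim_root ?dvdn_part //.
  by rewrite -DN mulKn // part_gt0.
(* the Chinese remainder with prescribed residues modulo the two parts of N *)
have crt a b : coprime a N -> coprime b N -> exists c,
    [/\ coprime c N, c = a %[mod P] & c = b %[mod m']].
  rewrite -DN !coprimeMr => /andP[coa _] /andP[_ cob].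
  exists (chinese P m' a b); rewrite chinese_modl // chinese_modr //; split=> //.
  rewrite coprimeMr -coprime_modl chinese_modl // coprime_modl coa.
  by rewrite -coprime_modl chinese_modr // coprime_modl.
have eq1 n a : (n %| N)%N -> a = 1 %[mod n`_p] -> a = 1 %[mod n`_p^'] ->
    a = 1 %[mod n].
  move=> n_dv ap ap'; rewrite -(partnC p (dvdn_gt0 N_gt0 n_dv)); apply/eqP.
  by rewrite chinese_remainder ?coprime_partC // ap ap' !eqxx.
have partW pi n : (n %| N)%N -> (n`_pi %| N`_pi)%N by apply: partn_dvd.
have [n_dv fixS minS] := conductor_cyc_fixed SQ.
have [m_dv fixT minT] := conductor_cyc_fixed TQ.
move: (conductor S) (conductor T) => n m in n_dv fixS minS m_dv fixT minT *.
have co1: coprime 1 N by rewrite coprime1n.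
have m_le_np: (m <= n`_p)%N.
  apply: minT => [|a coa a1 x Tx]; first by rewrite (dvdn_trans (dvdn_part p n)).
  have [b [cob ba b1]] := crt a 1%N coa co1.
  rewrite (conjT a b) //; move: x Tx; apply/(fixST b cob b1).
  move=> x Sx; apply: fixS => //; apply: eq1 => //.
    by rewrite -a1; apply: eqmodW ba; apply: partW.
  by apply: eqmodW b1; apply: partW.
have mp_m: (m`_p = m)%N.
  apply/eqP; rewrite eqn_leq dvdn_leq ?dvdn_part ?(dvdn_gt0 N_gt0) //=.
  apply: minT => [|a coa a1 x Tx]; first by rewrite (dvdn_trans (dvdn_part p m)).
  have [b [cob ba b1]] := crt a 1%N coa co1.
  rewrite (conjT a b) //; apply: fixT => //; apply: eq1 => //.
    by rewrite -a1; apply: eqmodW ba; apply: partW.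
  by apply: eqmodW b1; apply: partW.
apply/eqP; rewrite eqn_leq m_le_np andbT.
have mP: (m %| P)%N by rewrite -mp_m; apply: partW.
have mn_dv: (m * n`_p^' %| N)%N by rewrite -DN dvdn_mul ?partW.
have n_gt0 := dvdn_gt0 N_gt0 n_dv.
suff: (n <= m * n`_p^')%N.
  by rewrite -[X in (X <= _)%N](partnC p n_gt0) leq_pmul2r ?part_gt0.
apply: minS => // a coa a1 x Sx.
have [b [cob ba b1]] := crt a 1%N coa co1.
have [c [coc c1 ca]] := crt 1%N a co1 coa.
have bx: conj b x = x.
  move: x Sx; apply/(fixST b cob b1) => x Tx; rewrite (conjT b a) //.
  by apply: fixT => //; apply: eqmodW a1; apply: dvdn_mulr.
have cx: conj c x = x.
  apply: fixS => //; apply: eq1 => //; first by apply: eqmodW c1; apply: partW.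
  rewrite -(eqmodW (dvdn_mull m (dvdnn n`_p^')) a1).
  by apply: eqmodW ca; apply: partW.
rewrite (@eq_cyc_conj _ (b * c)) ?cyc_conjM //; try exact: SQ.
apply/eqP; rewrite -DN chinese_remainder //; apply/andP; split; apply/eqP.
  by rewrite -modnMm ba c1 modnMm muln1.
by rewrite -modnMm b1 ca modnMm mul1n.
Qed.

End ConductorPart.

(** * Intertwiners and separation of irreducible representations *)

Section Intertwiners.

Variables (F : fieldType) (gT : finGroupType) (G : {group gT}).

(** B is a homomorphism of G-modules, acting on the right of row vectors. *)
Definition mx_intertwine n1 (rG1 : mx_representation F G n1) n2
    (rG2 : mx_representation F G n2) (B : 'M_(n1, n2)) :=
  forall x, x \in G -> rG1 x *m B = B *m rG2 x.

Lemma irr_intertwine_rsim n1 (rG1 : mx_representation F G n1) n2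
    (rG2 : mx_representation F G n2) (B : 'M_(n1, n2)) :
    mx_irreducible rG1 -> mx_irreducible rG2 -> mx_intertwine rG1 rG2 B ->
  B != 0 -> mx_rsim rG1 rG2.
Proof.
move=> /mx_irrP[_ irr1] /mx_irrP[_ irr2] homB nzB.
have freeB: row_free B.
  rewrite -kermx_eq0; apply: contraR nzB => nzK.
  have: row_full (kermx B).
    apply: irr1 nzK; apply/mxmoduleP=> x Gx.
    by rewrite sub_kermx -mulmxA homB // mulmxA mulmx_ker mul0mx.
  by rewrite -sub1mx sub_kermx mul1mx.
have fullB: row_full <<B>>%MS.
  apply: irr2; last by rewrite -mxrank_eq0 genmxE mxrank_eq0.
  apply/mxmoduleP=> x Gx; rewrite genmxE (eqmxMr _ (genmxE _)) -homB //.
  exact: submxMl.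
exists B => //; rewrite -(eqP freeB).
by move: fullB; rewrite /row_full genmxE => /eqP.
Qed.

(** A simple quotient rG of the submodule U that is trivial on the common kernel
    of the homomorphisms S j to simple modules is one of these: at the first j
    where T vanishes on the kernel, T factors through S j. *)
Lemma irr_quotient_rsim N (rN : mx_representation F G N) (J : eqType)
    (d : J -> nat) (r : forall j, mx_representation F G (d j))
    (S : forall j, 'M[F]_(N, d j)) n (rG : mx_representation F G n)
    (T : 'M_(N, n)) (js : seq J) (U : 'M_N) :
    (forall j, mx_irreducible (r j)) -> mx_irreducible rG ->
    (forall j, mx_intertwine rN (r j) (S j)) -> mx_intertwine rN rG T ->
    mxmodule rN U -> U *m T != 0 ->
    (forall a : 'rV_N, (a <= U)%MS -> (forall j, j \in js -> a *m S j = 0) ->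
       a *m T = 0) ->
  exists j, mx_rsim (r j) rG.
Proof.
move=> irr_r irrG homS homT; elim: js U => [|j js IHjs] U modU nzUT kerT.
  case/eqP: nzUT; apply/row_matrixP=> i; rewrite row_mul row0.
  by apply: kerT; rewrite ?row_sub.
pose W := (U :&: kermx (S j))%MS.
have modW: mxmodule rN W.
  apply: capmx_module => //; apply/mxmoduleP=> x Gx.
  by rewrite sub_kermx -mulmxA homS // mulmxA mulmx_ker mul0mx.
have [WT0|nzWT] := eqVneq (W *m T) 0; last first.
  apply: (IHjs W) => // a; rewrite sub_capmx sub_kermx => /andP[aU /eqP aSj] a0.
  by apply: kerT => // j'; rewrite inE => /predU1P[->|/a0].
have kerW m (a : 'M_(m, N)) : (a <= U)%MS -> a *m S j = 0 -> a *m T = 0.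
  move=> aU aS; have /submxP[b ->]: (a <= W)%MS by rewrite sub_capmx aU sub_kermx aS /=.
  by rewrite -mulmxA WT0 mulmx0.
have fullUS: row_full (U *m S j).
  have /mx_irrP[_ irrj] := irr_r j; rewrite -sub1mx -(genmxE (U *m S j)) sub1mx.
  apply: irrj; last first.
    apply: contraNneq nzUT => US0; apply/eqP/kerW => //; apply/eqP.
    by rewrite -mxrank_eq0 -genmxE US0 mxrank0.
  apply/mxmoduleP=> x Gx; rewrite genmxE (eqmxMr _ (genmxE _)).
  by rewrite -mulmxA -homS // mulmxA submxMr // (mxmoduleP modU).
have [Y sYU YS1]: exists2 Y : 'M_(d j, N), (Y <= U)%MS & Y *m S j = 1%:M.
  have /row_fullP[X XUS] := fullUS; exists (X *m U); first exact: submxMl.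
  by rewrite -mulmxA.
exists j; apply: (irr_intertwine_rsim (B := Y *m T)) => // [x Gx|].
  apply/eqP; rewrite -subr_eq0 -(mulmxA Y) -homT // !mulmxA -mulmxBl.
  apply/eqP/kerW.
    rewrite addmx_sub ?eqmx_opp ?(mulmx_sub _ sYU) //.
    by apply: submx_trans (mxmoduleP modU x Gx); apply: submxMr.
  rewrite mulmxBl -(mulmxA Y) homS // -mulmxA (mulmxA Y) YS1.
  by rewrite mulmx1 mul1mx subrr.
apply: contraNneq nzUT => YT0; apply/eqP.
have: (U - U *m S j *m Y) *m T = 0.
  apply: kerW; first by rewrite addmx_sub ?eqmx_opp ?mulmx_sub.
  by rewrite mulmxBl -(mulmxA (U *m S j)) YS1 mulmx1 subrr.
by rewrite mulmxBl -(mulmxA (U *m S j)) YT0 mulmx0 subr0.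
Qed.

Lemma gring_mx_sum n (rG : mx_representation F G n) (a : 'rV_#|G|) :
  gring_mx rG a = \sum_i a 0 i *: rG (enum_val i).
Proof.
rewrite /gring_mx /= mulmx_sum_row linear_sum; apply: eq_bigr => i _.
by rewrite linearZ /= rowK mxvecK.
Qed.

Lemma gring_mx1 n (rG : mx_representation F G n) :
  gring_mx rG (gring_row 1%:M) = 1%:M.
Proof. by rewrite -gring_opE gring_op1. Qed.

(** An irreducible representation that is not similar to any of the r i is not
    trivial on the common annihilator of the r i in the group ring. *)
Lemma irr_gring_separation (I : finType) (d : I -> nat)
    (r : forall i, mx_representation F G (d i)) n
    (rG : mx_representation F G n) :
    (forall i, mx_irreducible (r i)) -> mx_irreducible rG ->
    (forall i, ~ mx_rsim (r i) rG) ->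
  exists2 a : 'rV_#|G|, forall i, gring_mx (r i) a = 0 & gring_mx rG a != 0.
Proof.
move=> irr_r irrG nsim; apply: contrapT => no_a.
have ann a : (forall i, gring_mx (r i) a = 0) -> gring_mx rG a = 0.
  by move=> ra0; apply/eqP/negP=> /negP nza; case: no_a; exists a.
have [n_gt0 _] := (mx_irrP rG).1 irrG; pose i0 := Ordinal n_gt0.
pose T m (rm : mx_representation F G m) (v : 'rV_m) :=
  lin1_mx (mulmx v \o gring_mx rm).
have T_E m (rm : mx_representation F G m) v a : a *m T m rm v = v *m gring_mx rm a.
  by rewrite mul_rV_lin1.
have homT m (rm : mx_representation F G m) v :
    mx_intertwine (regular_repr F G) rm (T m rm v).
  move=> x Gx; apply/row_matrixP=> i; rewrite !row_mul !rowE ?mulmxA.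
  by rewrite T_E gring_mxJ // T_E mulmxA.
have [j] : exists j : {i : I & 'I_(d i)}, mx_rsim (r (tag j)) rG.
  apply: (@irr_quotient_rsim _ (regular_repr F G) {i : I & 'I_(d i)}
    (fun j => d (tag j)) (fun j => r (tag j))
    (fun j => T _ (r (tag j)) (delta_mx 0 (tagged j))) n rG
    (T _ rG (delta_mx 0 i0)) (enum {: {i : I & 'I_(d i)}}) 1%:M) => //.
  - exact: mxmodule1.
  - rewrite mul1mx; apply: contraTneq isT => T0.
    have := T_E _ rG (delta_mx 0 i0) (gring_row 1%:M).
    rewrite T0 mulmx0 gring_mx1 mulmx1 => /matrixP/(_ 0 i0)/eqP.
    by rewrite !mxE !eqxx eq_sym oner_eq0.
  move=> a _ Sa0; rewrite T_E ann ?mulmx0 // => i; apply/row_matrixP=> l.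
  by rewrite rowE row0 -T_E (Sa0 (Tagged (fun i => 'I_(d i)) l)) ?mem_enum.
exact: nsim.
Qed.

Lemma irr_quotient_exists n (rG : mx_representation F G n) : (0 < n)%N ->
  exists m (rm : mx_representation F G m) (T : 'M_(n, m)),
    [/\ mx_irreducible rm, mx_intertwine rG rm T & T != 0].
Proof.
elim/ltn_ind: n rG => n IHn rG n_gt0.
have [irrG|redG] := pselect (mx_irreducible rG).
  exists n, rG, 1%:M; split=> // [x Gx|]; first by rewrite mul1mx mulmx1.
  by rewrite -mxrank_eq0 mxrank1 -lt0n.
have [U [modU nzU nfU]] : exists U : 'M_n, [/\ mxmodule rG U, U != 0 & ~~ row_full U].
  apply: contrapT => noU; apply/redG/mx_irrP; split=> // U modU nzU.
  by apply: contrapT => /negP nfU; apply: noU; exists U.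
have [||m [rm [T [irr_rm homT nzT]]]] := IHn _ _ (factmod_repr modU).
- by rewrite mxrank_coker ltn_subrL n_gt0 andbT lt0n mxrank_eq0.
- by rewrite mxrank_coker subn_gt0 ltn_neqAle rank_leq_col andbT.
exists m, rm, (in_factmod U 1%:M *m T); split=> // [x Gx|].
  have homU: rG x *m in_factmod U 1%:M = in_factmod U 1%:M *m factmod_repr modU x.
    by rewrite -in_factmodE -[rG x]mul1mx (in_factmodJ modU).
  by rewrite mulmxA homU -mulmxA homT // mulmxA.
apply: contraNneq nzT => T0; apply/eqP.
by rewrite -[T]mul1mx -(val_factmodK (U := U) 1%:M) in_factmodE -mulmxA T0 mulmx0.
Qed.

Lemma intertwine_gring_mx n1 (rG1 : mx_representation F G n1) n2
    (rG2 : mx_representation F G n2) (B : 'M_(n1, n2)) a :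
  mx_intertwine rG1 rG2 B -> gring_mx rG1 a *m B = B *m gring_mx rG2 a.
Proof.
move=> homB; rewrite !gring_mx_sum mulmx_suml mulmx_sumr.
by apply: eq_bigr => i _; rewrite -scalemxAl -scalemxAr homB ?enum_valP.
Qed.

Lemma irr_intertwine_full n1 (rG1 : mx_representation F G n1) n2
    (rG2 : mx_representation F G n2) (B : 'M_(n1, n2)) :
    mx_irreducible rG2 -> mx_intertwine rG1 rG2 B -> B != 0 -> row_full B.
Proof.
move=> /mx_irrP[_ irr2] homB nzB; rewrite /row_full -genmxE; apply: irr2.
  apply/mxmoduleP=> x Gx; rewrite genmxE (eqmxMr _ (genmxE _)) -homB //.
  exact: submxMl.
by rewrite -mxrank_eq0 genmxE mxrank_eq0.
Qed.

Lemma envelop_gring_mx n (rG : mx_representation F G n) (A : 'M_n) :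
  (A \in enveloping_algebra_mx rG)%MS -> exists a, A = gring_mx rG a.
Proof.
case/submxP=> a Da; exists a.
by rewrite /gring_mx /= -Da mxvecK.
Qed.

End Intertwiners.

(** * Traces over a splitting field of characteristic p *)

(** Factor A = C R through its rank: R C has the same trace and a smaller
    nilpotency index. *)
Lemma mxtrace_nilpotent (F : fieldType) n (A : 'M[F]_n) m :
  A ^+ m = 0 -> \tr A = 0.
Proof.
elim: m n A => [|m IHm] n A Am0.
  by rewrite -[A]mulmx1 -[1%:M]/(A ^+ 0) Am0 mulmx0 mxtrace0.
rewrite -[in LHS](mulmx_base A) mxtrace_mulC; apply: IHm.
set C := col_base A; set R := row_base A.
have powA k : C *m (R *m C) ^+ k *m R = A ^+ k.+1.
  elim: k => [|k IHk]; first by rewrite mulmx1 mulmx_base.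
  have ->: C *m (R *m C) ^+ k.+1 = C *m (R *m C) ^+ k *m R *m C.
    by rewrite exprSr -[_ * _]/(_ *m _) !mulmxA.
  by rewrite IHk -mulmxA mulmx_base -[_ *m _]/(_ * _) -exprSr.
have := powA m; rewrite Am0 -mulmxA -[RHS](mulmx0 _ C).
move/(row_full_inj (col_base_full A)); rewrite -[RHS](mul0mx _ R).
exact/(row_free_inj (row_base_free A)).
Qed.

Lemma mxtrace_mul_delta (R : comNzRingType) n (A : 'M[R]_n) i j :
  \tr (A *m delta_mx j i) = A i j.
Proof.
rewrite -(mul_delta_mx (0 : 'I_1)) mulmxA mxtrace_mulC mulmxA -rowE -colE.
by rewrite /mxtrace big_ord1 !mxE.
Qed.

Lemma unipotent_sub1_nilpotent (F : fieldType) p n (A : 'M[F]_n) e :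
  p \in [pchar F] -> A ^+ (p ^ e) = 1%:M -> (A - 1%:M) ^+ (p ^ e) = 0.
Proof.
case: n A => [|n] A charFp Ae; first by apply/matrixP; case.
have charXp: p \in [pchar {poly F}] by rewrite (rmorph_pchar polyC).
have XBn: ('X - 1) ^+ (p ^ e) = 'X^(p ^ e) - 1 :> {poly F}.
  apply/eqP; rewrite eq_sym subr_eq -[X in _ + X](expr1n _ (p ^ e)).
  rewrite -exprDn_pchar ?subrK // pnatX pnatE ?charXp //.
  exact: pcharf_prime charFp.
have /(congr1 (horner_mx A)) := XBn; rewrite !rmorphXn !rmorphB !rmorphXn /=.
by rewrite horner_mx_X rmorph1 Ae subrr.
Qed.

Section PRegularTrace.

Variables (F : fieldType) (p : nat) (gT : finGroupType) (G : {group gT}).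
Hypothesis charFp : p \in [pchar F].

Lemma repr_mx_exp (R : comUnitRingType) n (rG : mx_representation R G n) x k :
  x \in G -> rG (x ^+ k)%g = rG x ^+ k.
Proof.
move=> Gx; elim: k => [|k IHk]; first by rewrite expg0 repr_mx1.
by rewrite expgS repr_mxM ?groupX // IHk exprS.
Qed.

Lemma mxtrace_p_regular_part n (rG : mx_representation F G n) x :
  x \in G -> \tr (rG x) = \tr (rG x.`_p^')%g.
Proof.
move=> Gx; have Gxp: x.`_p%g \in G by rewrite groupX.
have Gxp': x.`_p^'%g \in G by rewrite groupX.
have p_pr := pcharf_prime charFp.
have [e De] := p_natP (p_elt_constt p x).
have up: rG x.`_p%g ^+ (p ^ e) = 1%:M.
  by rewrite -repr_mx_exp // -De expg_order repr_mx1.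
apply/eqP; rewrite -subr_eq0 -raddfB /=; apply/eqP.
have ->: rG x - rG x.`_p^'%g = (rG x.`_p%g - 1%:M) *m rG x.`_p^'%g.
  by rewrite mulmxBl mul1mx -repr_mxM // consttC.
apply: (@mxtrace_nilpotent _ _ _ (p ^ e)).
rewrite -[_ *m _]/(_ * _) exprMn_comm ?(unipotent_sub1_nilpotent charFp up) ?mul0r //.
apply: commr_sym; apply: commrB; last exact: commr1.
rewrite /GRing.comm -[LHS]/(_ *m _) -[RHS]/(_ *m _) -!repr_mxM //.
by congr (rG _); apply: commuteX2.
Qed.

End PRegularTrace.

Section SplitTraces.

Variables (F F' : fieldType) (f : {rmorphism F -> F'}).
Variables (gT : finGroupType) (G : {group gT}) (I : finType) (d : I -> nat).
Variable r : forall i, mx_representation F G (d i).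
Hypothesis splitF' : group_splitting_field F' G.
Hypothesis irr_r : forall i, mx_irreducible (r i).
Hypothesis nsim_r : forall i j, i != j -> ~ mx_rsim (r i) (r j).

Local Notation rf i := (map_repr f (r i)).

(** A group ring element acting nontrivially on the irreducible r i still acts
    nontrivially, after extension of scalars, on the target of every nonzero
    homomorphism from r i. *)
Lemma map_irr_quotient_neq0 i n (rn : mx_representation F' G n) T a :
    mx_intertwine (rf i) rn T -> T != 0 ->
  gring_mx (r i) a != 0 -> gring_mx rn (map_mx f a) != 0.
Proof.
move=> homT nzT nza; apply: contraNneq nzT => a0.
have MT0: map_mx f (gring_mx (r i) a) *m T = 0.
  by rewrite map_gring_mx (intertwine_gring_mx _ homT) a0 mulmx0.
have [u Mu nzu]: exists2 u : 'rV_(d i), (u <= gring_mx (r i) a)%MS & u != 0.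
  by exists (nz_row (gring_mx (r i) a)); rewrite ?nz_row_sub ?nz_row_eq0.
have uT0: map_mx f u *m T = 0.
  by have /submxP[v ->] := Mu; rewrite map_mxM -mulmxA MT0 mulmx0.
have [_ _ /(_ _ (cyclic_mx_module (r i) u) (submx1 _))] := irr_r i.
rewrite cyclic_mx_eq0 => /(_ nzu) full_u.
apply/eqP/row_matrixP=> l; rewrite row0 rowE.
have /cyclic_mxP[A EA Dl] : ((delta_mx 0 l : 'rV_(d i)) <= cyclic_mx (r i) u)%MS.
  by apply: submx_trans full_u; apply: submx1.
have [c Dc] := envelop_gring_mx EA.
rewrite -(map_delta_mx f) Dl map_mxM Dc map_gring_mx -mulmxA.
by rewrite (intertwine_gring_mx _ homT) mulmxA uT0 mul0mx.
Qed.

(** The functions t i are traces of irreducible quotients of the r i over F'.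
    Neither F nor the r i are assumed to be split: the trace of r i itself could
    vanish. *)
Lemma irr_split_traces :
  exists t : I -> gT -> F',
    (forall i, exists n (rn : mx_representation F' G n),
       t i =1 (fun x => \tr (rn x))) /\
    (forall c : I -> F', (forall x, x \in G -> \sum_i c i * t i x = 0) ->
       forall i, c i = 0).
Proof.
have quo i : exists q : {n : nat & mx_representation F' G n},
    mx_irreducible (tagged q) /\ exists2 T, row_full T &
       mx_intertwine (rf i) (tagged q) T.
  have [d_gt0 _] := (mx_irrP _).1 (irr_r i).
  have [n [rn [T [irrn homT nzT]]]] := irr_quotient_exists (rf i) d_gt0.
  exists (existT _ n rn); split=> //; exists T => //.
  exact: irr_intertwine_full irrn homT nzT.
have [q qP] := choice quo.
have /choice[b bP] : forall j, exists b : 'rV_#|G|, forall i,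
    (\tr (gring_mx (tagged (q i)) b) != 0) = (i == j).
  move=> j.
  have [irrj [T fullT homT]] := qP j.
  have [a rja nza] := @irr_gring_separation F gT G {i | i != j}
     (fun i => d (val i)) (fun i => r (val i)) _ (r j)
     (fun i => irr_r (val i)) (irr_r j) (fun i => nsim_r (valP i)).
  have [n_gt0 _] := (mx_irrP _).1 irrj.
  have nzT: T != 0.
    by apply: contraTneq fullT => ->; rewrite /row_full mxrank0 eq_sym -lt0n.
  have := map_irr_quotient_neq0 homT nzT nza.
  case/matrix0Pn=> x [y nzxy].
  have [|c Dc] := @envelop_gring_mx _ _ _ _ (tagged (q j)) (delta_mx y x).
    by have /andP[_] := splitF' irrj; apply: submx_full.
  exists (map_mx f a *m gring_mx (regular_repr F' G) c) => i.
  rewrite gring_mxA; have [->|nij] := eqVneq i j.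
    by rewrite -Dc mxtrace_mul_delta.
  have [irri [Ti fullTi homTi]] := qP i.
  suff ->: gring_mx (tagged (q i)) (map_mx f a) = 0.
    by rewrite mul0mx mxtrace0 eqxx.
  apply: (row_full_inj fullTi); rewrite mulmx0 -(intertwine_gring_mx _ homTi).
  by rewrite -map_gring_mx (rja (exist _ i nij)) map_mx0 mul0mx.
exists (fun i x => \tr (tagged (q i) x)); split=> [i|c c0 j].
  by exists (tag (q i)), (tagged (q i)).
apply/eqP; have := bP j j; rewrite eqxx /= => nzj.
have: \sum_i c i * \tr (gring_mx (tagged (q i)) (b j)) = 0.
  transitivity (\sum_k b j 0 k * \sum_i c i * \tr (tagged (q i) (enum_val k))).
    under [RHS]eq_bigr do rewrite mulr_sumr.
    rewrite exchange_big /=; apply: eq_bigr => i _.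
    rewrite gring_mx_sum raddf_sum /= mulr_sumr; apply: eq_bigr => k _.
    by rewrite mxtraceZ mulrCA.
  by rewrite big1 // => k _; rewrite c0 ?mulr0 ?enum_valP.
rewrite (bigD1 j) //= big1 ?addr0 => [/eqP|i nij].
  by rewrite mulf_eq0 (negPf nzj) orbF.
have := bP j i; rewrite (negPf nij) => /negbFE/eqP->.
by rewrite mulr0.
Qed.

End SplitTraces.

(** The conjugacy classes of G whose elements have order prime to p. *)
Definition p_regular_classes (gT : finGroupType) (p : nat) (G : {group gT}) :=
  [set xG in classes G | p^'.-elt (repr xG)].

Lemma card_irr_p_regular_classes (F : fieldType) (p : nat)
    (gT : finGroupType) (G : {group gT}) (I : finType) (d : I -> nat)
    (r : forall i, mx_representation F G (d i)) :
    p \in [pchar F] -> (forall i, mx_irreducible (r i)) ->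
    (forall i j, i != j -> ~ mx_rsim (r i) (r j)) ->
  (#|I| <= #|p_regular_classes p G|)%N.
Proof.
move=> charFp irr_r nsim_r.
apply: (@group_splitting_field_exists gT G F) => -[F' f splitF'].
have charF'p: p \in [pchar F'] by rewrite (fmorph_pchar f).
have [t [t_tr t_free]] := irr_split_traces f splitF' irr_r nsim_r.
pose cls := p_regular_classes p G.
pose A : 'M[F']_(#|I|, #|cls|) :=
  \matrix_(i, j) t (enum_val i) (repr (enum_val j)).
suff freeA: row_free A by rewrite -(eqP freeA) rank_leq_col.
rewrite -kermx_eq0; apply/eqP/row_matrixP=> l; rewrite row0.
set c := row l _; have cA0: c *m A = 0 by rewrite -row_mul mulmx_ker row0.
have c0 := t_free (fun i => c 0 (enum_rank i)) _.
apply/rowP=> i; rewrite [RHS]mxE -(enum_valK i) c0 // => x Gx.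
have [xG clsx Dx]: exists2 xG, xG \in cls & forall i, t i x = t i (repr xG).
  exists (x.`_p^' ^: G)%g => [|j].
    rewrite inE mem_classes ?groupX //=.
    have [y _ ->] := repr_class G x.`_p^'%g.
    by rewrite p_eltJ p_elt_constt.
  have [n [rn Dt]] := t_tr j; have [y Gy ->] := repr_class G x.`_p^'%g.
  rewrite !Dt (mxtrace_p_regular_part charF'p) // !repr_mxM ?groupV ?groupM ?groupX //.
  by rewrite mxtrace_mulC -mulmxA -repr_mxM ?groupV // mulgV repr_mx1 mulmx1.
have /matrixP/(_ 0 (enum_rank_in clsx xG)) := cA0; rewrite !mxE => cx0.
rewrite -[RHS]cx0 [RHS](reindex_onto enum_rank enum_val) /= => [|j _]; last first.
  by rewrite enum_valK.
apply: eq_big => [j|j _]; first by rewrite enum_rankK eqxx.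
by rewrite !mxE enum_rankK enum_rankK_in // Dx.
Qed.

(** * Characteristic polynomials *)

Section CharPoly.

Variable F : fieldType.

Lemma char_poly_sim m n (X : 'M[F]_(m, n)) (Y : 'M_(n, m)) A :
  X *m Y = 1%:M -> Y *m X = 1%:M -> char_poly (X *m A *m Y) = char_poly A.
Proof.
move=> XY YX.
have Dm: m = n by apply/eqP; rewrite eqn_leq !(mulmx1_min XY, mulmx1_min YX).
case: _ / Dm in X Y A XY YX *.
have ->: char_poly (X *m A *m Y) =
    \det (map_mx polyC X *m char_poly_mx A *m map_mx polyC Y).
  rewrite /char_poly /char_poly_mx mulmxBr mulmxBl -!map_mxM; congr (\det (_ - _)).
  by rewrite mul_mx_scalar -scalemxAl -map_mxM XY map_mx1 scalemx1.
rewrite !det_mulmx mulrAC -det_mulmx -map_mxM XY map_mx1 det1 mul1r //.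
Qed.

Lemma char_poly_lblock m n (A : 'M[F]_m) (C : 'M_(n, m)) (B : 'M_n) :
  char_poly (block_mx A 0 C B) = char_poly A * char_poly B.
Proof.
rewrite /char_poly /char_poly_mx map_block_mx raddf0 scalar_mx_block.
by rewrite opp_block_mx add_block_mx oppr0 addr0 det_lblock.
Qed.

Lemma char_poly_diag n (D : 'rV[F]_n) :
  char_poly (diag_mx D) = \prod_i ('X - (D 0 i)%:P).
Proof.
rewrite char_poly_trig ?diag_mx_is_trig //.
by apply: eq_bigr => i _; rewrite mxE eqxx.
Qed.

(** A matrix of order dividing m is diagonalizable when the field contains
    a primitive m-th root of unity. *)
Lemma finite_order_char_poly m (z : F) n (A : 'M[F]_n) :
    m.-primitive_root z -> A ^+ m = 1%:M ->
  exists xs : seq F, [/\ forall x, x \in xs -> x ^+ m = 1,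
    char_poly A = \prod_(x <- xs) ('X - x%:P) & \tr A = \sum_(x <- xs) x].
Proof.
case: n A => [|n] A pz Am.
  exists [::]; split=> //; rewrite ?big_nil; first exact: det_mx00.
  by rewrite /mxtrace big_ord0.
have [|P Pu /diagonalizable_forPex[D /(simmxLR Pu) DA]] := (diagonalizableP A).2.
  exists [seq z ^+ i | i <- index_iota 0 m].
    rewrite map_inj_in_uniq ?iota_uniq // => i j; rewrite !mem_index_iota /=.
    move=> im jm /eqP; rewrite (eq_prim_root_expr pz) !modn_small //.
    by move/eqP.
  rewrite big_map (factor_Xn_sub_1 pz); apply: mxminpoly_min.
  by rewrite rmorphB rmorphXn /= horner_mx_X rmorph1 Am subrr.
have uP' : invmx P \in unitmx by rewrite unitmx_inv.
rewrite mxpoly.conjVmx // in DA.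
have Dm i : D 0 i ^+ m = 1.
  have: (diag_mx D) ^+ m = 1%:M.
    have ->: diag_mx D = P *m A *m invmx P by rewrite DA !mulmxA mulmxV // mul1mx mulmxK.
    have powP k : (P *m A *m invmx P) ^+ k = P *m A ^+ k *m invmx P.
      elim: k => [|k IHk]; first by rewrite mulmx1 mulmxV.
      by rewrite exprS IHk exprS -![_ * _]/(_ *m _) !mulmxA mulmxKV.
    by rewrite powP Am mulmx1 mulmxV.
  have powD k : (diag_mx D) ^+ k = diag_mx (\row_j (D 0 j ^+ k)).
    elim: k => [|k IHk].
      by apply/matrixP=> a b; rewrite !mxE expr0.
    rewrite exprS IHk -[_ * _]/(_ *m _) mulmx_diag; congr diag_mx.
    by apply/rowP=> j; rewrite !mxE exprS.
  by rewrite powD => /matrixP/(_ i i); rewrite !mxE eqxx.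
exists [seq D 0 i | i <- index_enum 'I_n.+1]; split.
- by move=> x /mapP[i _ ->].
- by rewrite big_map -char_poly_diag DA char_poly_sim ?mulVmx ?mulmxV.
by rewrite DA -mulmxA mxtrace_mulC mulmxK // mxtrace_diag big_map.
Qed.

Lemma char_poly_sub_fact (gT : finGroupType) (G : {group gT}) n
    (rG : mx_representation F G n) (U : 'M_n) (modU : mxmodule rG U) x :
    x \in G ->
  char_poly (rG x) = char_poly (submod_repr modU x) * char_poly (factmod_repr modU x).
Proof.
move=> Gx; pose X := col_mx (val_submod (U := U) 1%:M) (val_factmod (U := U) 1%:M).
pose Y := row_mx (in_submod U (1%:M : 'M_n)) (in_factmod U (1%:M : 'M_n)).
have YX : Y *m X = 1%:M.
  by rewrite mul_row_col -val_submodE -val_factmodE add_sub_fact_mod.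
have XY : X *m Y = 1%:M.
  have Dn : (\rank U + \rank (cokermx U) = n)%N by rewrite mxrank_coker subnKC ?rank_leq_col.
  by move: X Y YX; rewrite Dn => X Y; apply: mulmx1C.
rewrite -(char_poly_sim (rG x) XY YX) mul_col_mx mul_col_row.
rewrite -!in_submodE -!in_factmodE.
have ->: in_factmod U (val_submod (U := U) 1%:M *m rG x) = 0.
  apply/eqP; rewrite in_factmod_eq0.
  by apply: submx_trans (mxmoduleP modU x Gx); rewrite submxMr ?val_submodP.
by rewrite char_poly_lblock.
Qed.

End CharPoly.

(** * Lifting roots of unity in a modular system *)

Lemma exists_total_min (T : eqType) (le : T -> T -> Prop) (s : seq T) (x0 : T) :
    (forall x y, le x y \/ le y x) ->
    (forall x y z, le x y -> le y z -> le x z) -> x0 \in s ->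
  exists2 m, m \in s & forall x, x \in s -> le m x.
Proof.
move=> tot tr; elim: s x0 => // y s IHs x0 _.
have refl x : le x x by case: (tot x x).
case: s IHs => [_|z s IHs].
  by exists y; rewrite ?inE // => x; rewrite inE => /eqP->.
have [m ms minm] := IHs z (mem_head _ _).
have [my|ym] := tot m y.
  exists m; first by rewrite inE ms orbT.
  by move=> x; rewrite inE => /predU1P[->|/minm].
exists y; first exact: mem_head.
by move=> x; rewrite inE => /predU1P[->|/minm/(tr _ _ _ ym)].
Qed.

Section Modular.

Variables (p : nat) (O : idomainType) (K k : fieldType).
Variables (frac : {rmorphism O -> K}) (res : {rmorphism O -> k}).
Hypothesis p_prime : prime p.
Hypothesis sysOKk : pmodular_system p frac res.

Let frac_inj : injective frac := pmod_frac_inj sysOKk.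
Let charkp : p \in [pchar k] := pmod_char_res sysOKk.

(** Divisibility in K with respect to the valuation ring O. *)
Definition fdvd (x y : K) : Prop := exists c : O, y = frac c * x.

Lemma fdvd_trans x y z : fdvd x y -> fdvd y z -> fdvd x z.
Proof. by move=> [c ->] [d ->]; exists (d * c); rewrite rmorphM mulrA. Qed.

Lemma frac_eq0 a : (frac a == 0) = (a == 0).
Proof. by rewrite -(rmorph0 frac) (inj_eq frac_inj). Qed.

Lemma fdvd_total x y : fdvd x y \/ fdvd y x.
Proof.
have [t [nzt _ facO] _] := pmod_dvr sysOKk.
have [->|nzx] := eqVneq x 0; first by right; exists 0; rewrite rmorph0 mul0r.
have [->|nzy] := eqVneq y 0; first by left; exists 0; rewrite rmorph0 mul0r.
have [a [b nzb Dab]] := pmod_frac_quot sysOKk (y / x).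
have nza : a != 0.
  rewrite -frac_eq0; apply: contraNneq (mulf_neq0 nzy (invr_neq0 nzx)) => a0.
  by rewrite Dab a0 mul0r.
have [i [c uc Da]] := facO a nza; have [j [d ud Db]] := facO b nzb.
have nzfrac e : e \is a GRing.unit -> frac e != 0.
  by move=> ue; rewrite frac_eq0; apply: contraTneq ue => ->; rewrite unitr0.
have Dy : y = frac a / frac b * x by rewrite -Dab divfK.
have nzfb: frac b != 0 by rewrite frac_eq0.
have nzfa: frac a != 0 by rewrite frac_eq0.
have [le_ji|/ltnW le_ij] := leqP j i.
  left; exists (c * d^-1 * t ^+ (i - j)); rewrite Dy; congr (_ * x).
  apply: (canLR (mulfK nzfb)); rewrite -rmorphM Db; congr (frac _).
  by rewrite Da -{1}(subnK le_ji) exprD !mulrA (mulrAC _ _ d) divrK.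
right; exists (d * c^-1 * t ^+ (j - i)).
have ->: frac (d * c^-1 * t ^+ (j - i)) = frac b / frac a.
  apply: (canRL (mulfK nzfa)); rewrite -rmorphM Da; congr (frac _).
  by rewrite Db -{2}(subnK le_ij) exprD !mulrA (mulrAC _ _ c) divrK.
by rewrite Dy mulrA -invf_div mulVf ?mul1r // mulf_neq0 ?invr_eq0.
Qed.

Lemma frac_unity_root m x : (0 < m)%N -> x ^+ m = 1 ->
  exists2 z, x = frac z & z ^+ m = 1.
Proof.
move=> m_gt0 xm; have [z Dx]: exists z, x = frac z.
  have [[z Dx]|[z Dx]] := fdvd_total 1 x; first by exists z; rewrite Dx mulr1.
  exists (z ^+ m.-1); rewrite rmorphXn -[LHS]mulr1 -(expr1n _ m.-1) Dx exprMn.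
  by rewrite mulrCA -exprS prednK // xm mulr1.
exists z => //; apply: frac_inj.
by rewrite rmorphXn -Dx xm rmorph1.
Qed.

Variables (N : nat) (w : K).
Hypothesis pw : N.-primitive_root w.

Lemma res_primitive_root m : (m %| N)%N -> ~~ (p %| m)%N ->
  exists2 z, m.-primitive_root (frac z) & m.-primitive_root (res z).
Proof.
move=> m_dv p'm; have px: m.-primitive_root (w ^+ (N %/ m)) by apply: dvdn_prim_root.
have m_gt0 := prim_order_gt0 px.
have [z Dz zm] := frac_unity_root m_gt0 (prim_expr_order px).
rewrite Dz in px; exists z => //; set y := res z.
have ym: y ^+ m = 1 by rewrite -rmorphXn zm rmorph1.
have [d pd d_dv] := prim_order_exists m_gt0 ym.
have facO: \prod_(0 <= i < m) ('X - (z ^+ i)%:P) = 'X^m - 1.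
  apply: (map_inj_poly frac_inj (rmorph0 frac)).
  rewrite rmorph_prod rmorphB /= map_polyXn rmorph1.
  rewrite -(factor_Xn_sub_1 px); apply: eq_bigr => i _.
  by rewrite map_polyXsubC rmorphXn.
have: uniq (mkseq (fun i => y ^+ i) m).
  rewrite -separable_prod_XsubC; set q := \prod_(_ <- _) _.
  have ->: q = 'X^m - 1.
    rewrite /q /mkseq big_map -[m in iota 0 m]subn0.
    have := congr1 (map_poly res) facO.
    rewrite rmorph_prod rmorphB /= map_polyXn rmorph1 => <-.
    by apply: eq_bigr => i _; rewrite map_polyXsubC (rmorphXn res).
  by apply: separable_Xn_sub_1; rewrite -(dvdn_pcharf charkp).
move/mkseq_uniqP=> inj_y; suff <-: d = m by [].
apply/eqP; rewrite eqn_leq dvdn_leq //= leqNgt; apply/negP=> lt_dm.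
have := inj_y d 0%N; rewrite !inE expr0 (prim_expr_order pd).
move=> /(_ lt_dm m_gt0 erefl) d0.
by have := prim_order_gt0 pd; rewrite d0.
Qed.

(** Reduction is injective on m-th roots of unity when p does not divide m. *)
Lemma teichmuller_lift m : (m %| N)%N -> ~~ (p %| m)%N ->
  exists h : k -> K, forall z, z ^+ m = 1 -> h (res z) = frac z.
Proof.
move=> m_dv p'm; have [z pz prz] := res_primitive_root m_dv p'm.
exists (fun y =>
  xget 0 [set x | exists2 z, z ^+ m = 1 & res z = y /\ x = frac z]%classic).
move=> z1 z1m; set Q := [set _ | _]%classic.
have [z2 z2m [Dz2 ->]] : Q (xget 0 Q) by apply: xgetPex; exists (frac z1), z1.
have root_pow z' : z' ^+ m = 1 -> exists i : nat, z' = z ^+ i.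
  move=> /(congr1 frac); rewrite rmorphXn rmorph1 => /(prim_rootP pz)[i Di].
  by exists i; apply: frac_inj; rewrite rmorphXn.
have [i Di] := root_pow _ z1m; have [j Dj] := root_pow _ z2m.
have /eqP := Dz2; rewrite Di Dj !rmorphXn (eq_prim_root_expr prz).
by rewrite -(eq_prim_root_expr pz) => /eqP.
Qed.

Lemma brauer_lift_inj m n (A : 'M[k]_n) x y : (m %| N)%N -> ~~ (p %| m)%N ->
  brauer_lift frac res m A x -> brauer_lift frac res m A y -> x = y.
Proof.
move=> m_dv p'm [xs [xsm Ax ->]] [ys [ysm Ay ->]].
have [h hP] := teichmuller_lift m_dv p'm.
have Dsum zs : (forall z, z \in zs -> z ^+ m = 1) ->
    \sum_(z <- zs) frac z = \sum_(y <- [seq res z | z <- zs]) h y.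
  by move=> zsm; rewrite big_map; apply: eq_big_seq => z /zsm/hP.
rewrite !Dsum //; apply: perm_big; apply: prod_XsubC_eq.
by rewrite !big_map -Ax -Ay.
Qed.

Lemma brauer_lift_exists m n (A : 'M[k]_n) : (m %| N)%N -> ~~ (p %| m)%N ->
  A ^+ m = 1%:M -> exists x, brauer_lift frac res m A x.
Proof.
move=> m_dv p'm Am; have [z pz prz] := res_primitive_root m_dv p'm.
have [ys [ysm DA _]] := finite_order_char_poly prz Am.
have [zs zsm Dys]: exists2 zs, forall z, z \in zs -> z ^+ m = 1 &
    ys = [seq res z | z <- zs].
  elim: ys ysm {DA} => [|y ys IHys] ysm; first by exists [::].
  have [|zs zsm ->] := IHys; first by move=> x xys; rewrite ysm // inE xys orbT.
  have [i Dy] := prim_rootP prz (ysm y (mem_head _ _)).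
  exists (z ^+ i :: zs) => /= [x|]; last by rewrite rmorphXn -Dy.
  rewrite inE => /predU1P[->|/zsm//]; apply: frac_inj.
  by rewrite !rmorphXn -exprM mulnC exprM (prim_expr_order pz) expr1n rmorph1.
exists (\sum_(z <- zs) frac z), zs; split=> //.
by rewrite DA Dys big_map.
Qed.

(** The trace of an integral matrix of finite order is a Brauer lift for its
    reduction. *)
Lemma brauer_lift_reduction m n (A : 'M[O]_n) : (m %| N)%N ->
  map_mx frac A ^+ m = 1%:M ->
  brauer_lift frac res m (map_mx res A) (frac (\tr A)).
Proof.
move=> m_dv Am; have px: m.-primitive_root (w ^+ (N %/ m)) by apply: dvdn_prim_root.
have m_gt0 := prim_order_gt0 px.
have [xs [xsm DA trA]] := finite_order_char_poly px Am.
have [zs zsm Dxs]: exists2 zs, forall z, z \in zs -> z ^+ m = 1 &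
    xs = [seq frac z | z <- zs].
  elim: xs xsm {DA trA} => [|x xs IHxs] xsm; first by exists [::].
  have [|zs zsm ->] := IHxs; first by move=> y yxs; rewrite xsm // inE yxs orbT.
  have [z -> zm] := frac_unity_root m_gt0 (xsm x (mem_head _ _)).
  by exists (z :: zs) => //= y; rewrite inE => /predU1P[->|/zsm].
exists zs; split=> //; last by rewrite -trace_map_mx trA Dxs big_map.
have ->: char_poly (map_mx res A) = map_poly res (char_poly A) by rewrite map_char_poly.
have ->: char_poly A = \prod_(z <- zs) ('X - z%:P).
  apply: (map_inj_poly frac_inj (rmorph0 frac)).
  rewrite map_char_poly DA Dxs big_map rmorph_prod.
  by apply: eq_bigr => z _; rewrite /= map_polyXsubC.
by rewrite rmorph_prod; apply: eq_bigr => z _; rewrite /= map_polyXsubC.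
Qed.

End Modular.

(** * Characters on p-regular elements *)

Section BrauerCharacters.

Variables (p : nat) (O : idomainType) (K k : fieldType).
Variables (frac : {rmorphism O -> K}) (res : {rmorphism O -> k}).
Hypothesis p_prime : prime p.
Hypothesis sysOKk : pmodular_system p frac res.
Variables (N : nat) (w : K).
Hypothesis pw : N.-primitive_root w.
Variables (gT : finGroupType) (C : {group gT}).
Hypothesis C_dv : (#|C| %| N)%N.

Local Notation IBrC := (IBr p frac res C).
Local Notation brauer_char := (is_brauer_char p frac res (G := C)).

Lemma order_dvd_N (g : gT) : g \in C -> (#[g] %| N)%N.
Proof. by move=> Cg; apply: dvdn_trans (order_dvdG Cg) C_dv. Qed.

Lemma p_regular_ndvd (g : gT) : p^'.-elt g -> ~~ (p %| #[g])%N.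
Proof. by rewrite /p_elt p'natE. Qed.

Lemma repr_mx_order (R : comUnitRingType) n (rG : mx_representation R C n) g :
  g \in C -> rG g ^+ #[g] = 1%:M.
Proof. by move=> Cg; rewrite -repr_mx_exp // expg_order repr_mx1. Qed.

(** Among the rows of the matrices rG g, choose n of them with a determinant of
    least valuation: they form a basis of a lattice containing all these rows,
    hence stable under C. *)
Lemma repr_integral_form n (rG : mx_representation K C n) :
  exists (rO : mx_representation O C n) (B : 'M[K]_n), B \in unitmx /\
    forall g, g \in C -> map_mx frac (rO g) = B *m rG g *m invmx B.
Proof.
pose v (x : 'I_n * 'I_#|C|) : 'rV[K]_n := row x.1 (rG (enum_val x.2)).
pose M (f : {ffun 'I_n -> 'I_n * 'I_#|C|}) : 'M[K]_n := \matrix_i v (f i).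
pose f1 : {ffun 'I_n -> 'I_n * 'I_#|C|} := [ffun i => (i, gring_index C 1%g)].
have M1 : M f1 = 1%:M.
  by apply/row_matrixP=> i; rewrite rowK ffunE /v /= gring_indexK // repr_mx1.
have [f0 _ minf0] := @exists_total_min _ (fun f g => fdvd frac (\det (M f)) (\det (M g)))
  (enum {: {ffun 'I_n -> 'I_n * 'I_#|C|}}) f1
  (fun f g => fdvd_total sysOKk _ _) (fun f g h => @fdvd_trans _ _ _ _ _ _)
  (mem_enum _ _).
have {}minf0 f := minf0 f (mem_enum _ f); set B := M f0 in minf0.
have nzB: \det B != 0.
  have [c] := minf0 f1; rewrite M1 det1 => /eqP; apply: contraTneq => ->.
  by rewrite mulr0 oner_eq0.
have uB: B \in unitmx by rewrite unitmxE unitfE.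
(* Cramer's rule: the coordinates of a row v x in the basis B are quotients
   of minors det (M f) / det B, which are integral by the choice of B *)
have intB x j : exists c, (v x *m invmx B) 0 j = frac c.
  pose f : {ffun 'I_n -> 'I_n * 'I_#|C|} := [ffun i => if i == j then x else f0 i].
  have [c Dc] := minf0 f; exists c; rewrite /invmx uB -scalemxAr mxE.
  apply: (canLR (mulKf nzB)); rewrite mulrC -Dc (expand_det_row _ j) mxE.
  apply: eq_bigr => l _; rewrite !mxE ffunE eqxx; congr (_ * (_ * \det _)).
  by apply/matrixP=> a b; rewrite !mxE ffunE eq_sym (negPf (neq_lift _ _)).
have int_conj g i j : g \in C -> exists c, (B *m rG g *m invmx B) i j = frac c.
  move=> Cg; pose x := ((f0 i).1, gring_index C (enum_val (f0 i).2 * g)%g).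
  have [c Dc] := intB x j; exists c; rewrite -Dc.
  have <- : row i (B *m rG g *m invmx B) 0 j = (B *m rG g *m invmx B) i j by rewrite mxE.
  rewrite !row_mul rowK /v /x /= gring_indexK ?groupM ?enum_valP //.
  by rewrite repr_mxM ?enum_valP // row_mul.
pose lift (x : K) : O := xget 0 [set c | x = frac c]%classic.
have liftK c : lift (frac c) = c.
  apply: (pmod_frac_inj sysOKk).
  by rewrite -(@xgetPex _ 0 [set d | frac c = frac d]%classic) //; exists c.
pose r g : 'M[O]_n := map_mx lift (B *m rG g *m invmx B).
have rE g : g \in C -> map_mx frac (r g) = B *m rG g *m invmx B.
  move=> Cg; apply/matrixP=> i j; rewrite [LHS]mxE [in LHS]mxE.
  by have [c ->] := int_conj g i j Cg; rewrite liftK.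
have inj_frac_mx : injective (map_mx frac : 'M[O]_n -> 'M[K]_n).
  move=> A1 A2 /matrixP eqA; apply/matrixP=> i j.
  by have := eqA i j; rewrite !mxE => /(pmod_frac_inj sysOKk).
have r_repr : mx_repr C r.
  split=> [|g h Cg Ch]; apply: inj_frac_mx.
    by rewrite rE // repr_mx1 mulmx1 mulmxV // map_mx1.
  rewrite map_mxM !rE ?groupM // repr_mxM // !mulmxA; congr (_ *m _ *m _).
  by rewrite mulmxKV.
by exists (MxRepresentation r_repr), B.
Qed.

Lemma brauer_char_inj n (rk : mx_representation k C n) phi psi :
  brauer_char rk phi -> brauer_char rk psi -> phi = psi.
Proof.
move=> rk_phi rk_psi; apply/ffunP=> g; have := rk_phi g; have := rk_psi g.
case: ifP => [/andP[Cg /p_regular_ndvd p'g] psi_g phi_g|_ -> -> //].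
exact: (brauer_lift_inj sysOKk pw (order_dvd_N Cg) p'g phi_g psi_g).
Qed.

Lemma brauer_char_exists n (rk : mx_representation k C n) :
  exists phi, brauer_char rk phi.
Proof.
have lift g : exists x, if (g \in C) && p^'.-elt g
    then brauer_lift frac res #[g] (rk g) x else x = 0.
  case: (boolP ((g \in C) && _)) => [/andP[Cg /p_regular_ndvd p'g]|_]; last by exists 0.
  exact: (brauer_lift_exists sysOKk pw (order_dvd_N Cg) p'g (repr_mx_order _ Cg)).
have [phi phiP] := choice lift; exists [ffun g => phi g] => g.
by rewrite ffunE; apply: phiP.
Qed.

(** The Brauer character of any representation is the sum of those of its
    composition factors. *)
Lemma brauer_char_sum n (rk : mx_representation k C n) :
  exists s : seq {ffun gT -> K}, (forall phi, phi \in s -> IBrC phi) /\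
    brauer_char rk (\sum_(phi <- s) phi).
Proof.
elim/ltn_ind: n rk => n IHn rk.
have [irr_rk|red_rk] := pselect (mx_irreducible rk).
  have [phi rk_phi] := brauer_char_exists rk; exists [:: phi].
  split=> [psi|]; last by rewrite big_seq1.
  by rewrite inE => /eqP->; exists n, rk.
have [n0|n_gt0] := posnP n.
  exists [::]; split=> // g; rewrite big_nil ffunE; case: ifP => // _.
  exists [::]; split; rewrite ?big_nil //.
  by move: (rk g); rewrite n0 => A; apply: det_mx00.
have [U [modU nzU nfU]] : exists U : 'M_n, [/\ mxmodule rk U, U != 0 & ~~ row_full U].
  apply: contrapT => noU; apply/red_rk/mx_irrP; split=> // U modU nzU.
  by apply: contrapT => /negP nfU; apply: noU; exists U.
have [|s1 [s1P sub_s1]] := IHn _ _ (submod_repr modU).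
  by rewrite ltn_neqAle rank_leq_col andbT.
have [|s2 [s2P fact_s2]] := IHn _ _ (factmod_repr modU).
  by rewrite mxrank_coker ltn_subrL n_gt0 andbT lt0n mxrank_eq0.
exists (s1 ++ s2); split=> [phi|g].
  by rewrite mem_cat => /orP[/s1P|/s2P].
rewrite big_cat ffunE; have := sub_s1 g; have := fact_s2 g.
case: ifP => [/andP[Cg _] [zs2 [zs2m D2 ->]] [zs1 [zs1m D1 ->]]|_ -> ->].
  exists (zs1 ++ zs2); split=> [z||]; first by rewrite mem_cat => /orP[/zs1m|/zs2m].
    by rewrite (char_poly_sub_fact modU Cg) D1 D2 big_cat.
  by rewrite big_cat.
by rewrite addr0.
Qed.

Lemma p_regular_trace n (rG : mx_representation K C n) :
  exists s : seq {ffun gT -> K}, (forall phi, phi \in s -> IBrC phi) /\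
    forall g, g \in C -> p^'.-elt g -> \tr (rG g) = \sum_(phi <- s) phi g.
Proof.
have [rO [B [uB DrO]]] := repr_integral_form rG.
have [s [sP rk_s]] := brauer_char_sum (map_repr res rO).
exists s; split=> // g Cg p'g; have := rk_s g; rewrite Cg p'g /=.
have -> : \tr (rG g) = frac (\tr (rO g)).
  by rewrite -trace_map_mx DrO // mxtrace_mulC mulmxA mulVmx // mul1mx.
rewrite sum_ffunE; apply: (brauer_lift_inj sysOKk pw) => //.
- exact: order_dvd_N.
- exact: p_regular_ndvd.
apply: (brauer_lift_reduction sysOKk pw); first exact: order_dvd_N.
exact: (repr_mx_order (map_repr frac rO)).
Qed.

(** The image of an idempotent commuting with rG is a representation of C. *)
Lemma idempotent_repr n (rG : mx_representation K C n) (P : 'M_n) :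
    P *m P = P -> centgmx rG P ->
  exists m (rP : mx_representation K C m), forall g, g \in C ->
    \tr (rG g *m P) = \tr (rP g).
Proof.
move=> PP /centgmxP cGP; have DP := mulmx_base P.
have fullA := col_base_full P; have freeB := row_base_free P.
move: (\rank P) (col_base P) (row_base P) DP fullA freeB => r A B DP fullA freeB.
have BA : B *m A = 1%:M.
  have : A *m (B *m A) *m B = A *m 1%:M *m B.
    by rewrite mulmx1 !mulmxA DP -(mulmxA P) DP.
  by move/(row_free_inj freeB)/(row_full_inj fullA).
have r_repr : mx_repr C (fun g => B *m rG g *m A).
  split=> [|g h Cg Ch]; first by rewrite repr_mx1 mulmx1.
  have PA : P *m A = A by rewrite -{1}DP -mulmxA BA mulmx1.
  rewrite repr_mxM // -!mulmxA; congr (B *m (rG g *m _)).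
  by rewrite (mulmxA A) DP (mulmxA P) cGP // -mulmxA PA.
exists r, (MxRepresentation r_repr) => g Cg /=.
by rewrite -{1}DP mulmxA mxtrace_mulC mulmxA.
Qed.

(** The eigenspaces of A are C-modules on which A acts by powers of z; P i below
    is the projection to the eigenspace of z^i. *)
Lemma p_regular_trace_twist m (z : K) n (rG : mx_representation K C n) (A : 'M_n) :
    m.-primitive_root z -> centgmx rG A -> A ^+ m = 1%:M ->
  exists s : 'I_m -> seq {ffun gT -> K},
    (forall i phi, phi \in s i -> IBrC phi) /\
    forall g, g \in C -> p^'.-elt g ->
      \tr (rG g *m A) = \sum_(i < m) z ^+ i * \sum_(phi <- s i) phi g.
Proof.
move=> pz cGA Am; have m_gt0 := prim_order_gt0 pz.
have nzm : m%:R != 0 :> K.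
  by rewrite (proj1 (pcharf0P K) (pmod_char_frac sysOKk)) -lt0n.
have zm := prim_expr_order pz.
have nzz : z != 0 by rewrite (prim_root_eq0 pz) -lt0n.
have sum_z (a : nat) : \sum_(i < m) z ^+ (i * a) = if (m %| a)%N then m%:R else 0.
  case: ifP => [/dvdnP[b ->]|ndv].
    rewrite (eq_bigr (fun=> 1)) ?sumr_const ?card_ord // => i _.
    by rewrite mulnA mulnC exprM zm expr1n.
  have nza1 : z ^+ a - 1 != 0 by rewrite subr_eq0 -(prim_order_dvd pz) ndv.
  apply: (mulfI nza1); rewrite mulr0.
  have := subrX1 (z ^+ a) m; rewrite -exprM mulnC exprM zm expr1n subrr => E.
  by rewrite [RHS]E; congr (_ * _); apply: eq_bigr => i _; rewrite mulnC exprM.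
pose P (i : 'I_m) : 'M[K]_n := m%:R^-1 *: \sum_(j < m) z^-1 ^+ (i * j) *: A ^+ j.
have cGAX j : centgmx rG (A ^+ j).
  elim: j => [|j /centgmxP IHj]; first by apply/centgmxP=> x Cx; rewrite mulmx1 mul1mx.
  apply/centgmxP=> x Cx; rewrite exprS -[A * _]/(A *m _) -mulmxA IHj // mulmxA.
  by rewrite (centgmxP cGA) // mulmxA.
have cGP i : centgmx rG (P i).
  apply/centgmxP=> x Cx; rewrite /P -scalemxAl -scalemxAr; congr (_ *: _).
  rewrite mulmx_suml mulmx_sumr; apply: eq_bigr => j _.
  by rewrite -scalemxAl -scalemxAr (centgmxP (cGAX j)).
have AP i : A *m P i = z ^+ i *: P i.
  rewrite /P -scalemxAr scalerA mulrC -scalerA; congr (_ *: _).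
  pose t j := z^-1 ^+ (i * j) *: A ^+ j.
  have At (j : 'I_m) : A *m t j = z ^+ i *: t j.+1.
    rewrite /t -scalemxAr scalerA mulnS exprD mulrA -exprMn divff //.
    by rewrite expr1n mul1r exprS.
  have tm : t m = t 0%N.
    by rewrite /t Am muln0 mulnC exprM exprVn zm invr1 expr1n.
  rewrite mulmx_sumr (eq_bigr _ (fun j _ => At j)) -scaler_sumr; congr (_ *: _).
  apply: (addrI (t 0%N)); rewrite -[LHS](big_ord_recl m t).
  by rewrite big_ord_recr /= tm addrC.
have PP i : P i *m P i = P i.
  rewrite {1}/P -scalemxAl mulmx_suml.
  have AjP j : A ^+ j *m P i = z ^+ (i * j) *: P i.
    elim: j => [|j IHj]; first by rewrite mul1mx muln0 scale1r.
    rewrite exprS -[A * _]/(A *m _) -mulmxA IHj -scalemxAr AP scalerA.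
    by rewrite -exprD mulnS addnC.
  rewrite (eq_bigr (fun=> P i)) => [|j _].
    by rewrite sumr_const card_ord -scaler_nat scalerA mulVf // scale1r.
  by rewrite -scalemxAl AjP scalerA exprVn mulVf ?scale1r // expf_neq0.
have DA : A = \sum_(i < m) z ^+ i *: P i.
  pose j0 := Ordinal (ltn_pmod 1 m_gt0).
  have Aj0 : A ^+ j0 = A.
    rewrite -[RHS]expr1 [in RHS](divn_eq 1 m) exprD mulnC exprM Am.
    by rewrite -[1%:M]/(1 : 'M_n) expr1n mul1r.
  transitivity (\sum_(i < m) m%:R^-1 *:
      \sum_(j < m) z ^+ (i * (m - j).+1) *: A ^+ j); last first.
    apply: eq_bigr => i _; rewrite /P scalerA mulrC -scalerA; congr (_ *: _).
    rewrite scaler_sumr; apply: eq_bigr => j _; rewrite scalerA; congr (_ *: _).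
    rewrite mulnS exprD; congr (_ * _).
    apply: (mulIf (expf_neq0 (i * j) nzz)); rewrite -exprD -mulnDr subnK 1?ltnW //.
    by rewrite mulnC exprM zm expr1n exprVn mulVf // expf_neq0.
  rewrite -scaler_sumr exchange_big /=.
  under eq_bigr do rewrite -scaler_suml sum_z.
  rewrite (bigD1 j0) //= big1 => [|j nj].
    rewrite addr0 -subSn ?(ltnW (ltn_ord j0)) // -eqn_mod_dvd; last first.
      by apply: ltnW; rewrite ltnS ltnW ?(ltn_ord j0).
    by rewrite -addn1 modnDl /= modn_mod eqxx Aj0 scalerA mulVf ?scale1r.
  rewrite -subSn ?(ltnW (ltn_ord j)) // -eqn_mod_dvd; last first.
    by apply: ltnW; rewrite ltnS ltnW ?(ltn_ord j).
  rewrite -addn1 modnDl (modn_small (ltn_ord j)) eq_sym.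
  by rewrite -[_ == _]/(j == j0) (negPf nj) scale0r.
have /choice[s sP] i : exists s : seq {ffun gT -> K},
    (forall phi, phi \in s -> IBrC phi) /\
    forall g, g \in C -> p^'.-elt g -> \tr (rG g *m P i) = \sum_(phi <- s) phi g.
  have [d [rP DrP]] := idempotent_repr (PP i) (cGP i).
  have [s [sI sE]] := p_regular_trace rP; exists s; split=> // g Cg p'g.
  by rewrite DrP // sE.
exists s; split=> [i phi|g Cg p'g]; first by have [+ _] := sP i; apply.
rewrite {1}DA mulmx_sumr raddf_sum; apply: eq_bigr => i _ /=.
by rewrite -scalemxAr mxtraceZ; have [_ ->] := sP i.
Qed.

End BrauerCharacters.

(** * Linear independence of Brauer characters *)

Section BrauerIndependence.

Variables (p : nat) (O : idomainType) (K k : fieldType).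
Variables (frac : {rmorphism O -> K}) (res : {rmorphism O -> k}).
Hypothesis p_prime : prime p.
Hypothesis sysOKk : pmodular_system p frac res.
Variables (N : nat) (w : K).
Hypothesis pw : N.-primitive_root w.
Variables (gT : finGroupType) (C : {group gT}).
Hypothesis C_dv : (#|C| %| N)%N.

Local Notation IBrC := (IBr p frac res C).
Local Notation brauer_char := (is_brauer_char p frac res (G := C)).

Lemma brauer_char_rsim n1 (r1 : mx_representation k C n1) n2
    (r2 : mx_representation k C n2) phi :
  mx_rsim r1 r2 -> brauer_char r1 phi -> brauer_char r2 phi.
Proof.
move=> sim12 r1_phi g; have := r1_phi g; case: ifP => // /andP[Cg _].
case=> zs [zsm Dzs Dphi]; exists zs; split=> //; rewrite -Dzs.
have [B [B' B'B ->]] := mx_rsim_def (mx_rsim_sym sim12) => //.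
have Dn := mxrank_rsim sim12; rewrite char_poly_sim //.
by move: B B' B'B; rewrite Dn => B B' /mulmx1C.
Qed.

Lemma size_IBr_leq (bl : seq {ffun gT -> K}) :
    uniq bl -> (forall phi, phi \in bl -> IBrC phi) ->
  (size bl <= #|p_regular_classes p C|)%N.
Proof.
move=> Ubl blP; pose phi (i : 'I_(size bl)) := tnth (in_tuple bl) i.
have /choice[q qP] i : exists q : {n : nat & mx_representation k C n},
    mx_irreducible (tagged q) /\ brauer_char (tagged q) (phi i).
  have [n [rG [irrG rG_phi]]] := blP _ (mem_tnth i (in_tuple bl)).
  by exists (existT _ n rG).
rewrite -[size bl]card_ord.
apply: (@card_irr_p_regular_classes _ _ _ C _ (fun i => tag (q i))
  (fun i => tagged (q i)) (pmod_char_res sysOKk)) => [i | i j nij simij].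
  by have [] := qP i.
case/eqP: nij; have [_ q_i] := qP i; have [_ q_j] := qP j.
have := brauer_char_inj p_prime sysOKk pw C_dv (brauer_char_rsim simij q_i) q_j.
rewrite /phi !(tnth_nth 0) /= => /eqP; rewrite nth_uniq // => /eqP Dij.
exact: val_inj.
Qed.

Lemma IBr_enumeration :
  exists2 bl : seq {ffun gT -> K}, uniq bl & forall phi, IBrC phi <-> phi \in bl.
Proof.
pose ok n := `[< exists bl : seq {ffun gT -> K},
  [/\ uniq bl, forall phi, phi \in bl -> IBrC phi & size bl = n] >].
have ok0: exists n, ok n by exists 0%N; apply/asboolP; exists [::].
have ok_le n : ok n -> (n <= #|p_regular_classes p C|)%N.
  by case/asboolP=> bl [Ubl blP <-]; apply: size_IBr_leq.
case: (ex_maxnP ok0 ok_le) => n /asboolP[bl [Ubl blP Dn]] maxn.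
exists bl => // phi; split=> [phiI|/blP//]; apply: contrapT => /negP nphi.
suff: (n.+1 <= n)%N by rewrite ltnn.
apply: maxn; apply/asboolP; exists (phi :: bl); split=> /=.
- by rewrite nphi.
- by move=> psi; rewrite inE => /predU1P[->|/blP].
- by rewrite Dn.
Qed.

Variable bl : seq {ffun gT -> K}.
Hypotheses (Ubl : uniq bl) (blP : forall phi, IBrC phi <-> phi \in bl).

Lemma sum_count_IBr (s : seq {ffun gT -> K}) g :
    (forall phi, phi \in s -> IBrC phi) ->
  \sum_(phi <- s) phi g = \sum_(phi <- bl) (count_mem phi s)%:R * phi g.
Proof.
elim: s => [_|psi s IHs sI]; first by rewrite big_nil big1 // => phi _; rewrite mul0r.
rewrite big_cons IHs => [|phi phi_s]; last by apply: sI; rewrite inE phi_s orbT.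
under [RHS]eq_bigr do rewrite /= natrD mulrDl.
rewrite big_split /=; congr (_ + _).
have bl_psi: psi \in bl by apply/blP/sI/mem_head.
rewrite (bigD1_seq psi) //= eqxx mul1r big1 ?addr0 //.
by move=> phi npsi; rewrite eq_sym (negPf npsi) mul0r.
Qed.

(** Left translation by the inverse on the group algebra, which commutes with
    the regular representation. *)
Lemma left_regular_repr : mx_repr C (fun x : gT =>
  \matrix_(i < #|C|) (delta_mx 0 (gring_index C (x^-1 * enum_val i)%g) : 'rV[K]__)).
Proof.
split=> [|x y Cx Cy]; apply/row_matrixP=> i; rewrite !rowK.
  by rewrite invg1 mul1g row1 gring_valK.
rewrite row_mul rowK -rowE rowK gring_indexK ?groupM ?groupV ?enum_valP //.
by rewrite invMg mulgA.
Qed.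

(** The function t |-> tr(t s^-1) on the group algebra, with s^-1 acting by
    left translation, counts the x in C such that t is the conjugate of s by x. *)
Lemma class_separation s : s \in C ->
  exists2 d : {ffun gT -> K} -> K,
    p^'.-elt s -> \sum_(phi <- bl) d phi * phi s != 0
  & forall t, t \in C -> p^'.-elt t -> t \notin (s ^: C)%g ->
      \sum_(phi <- bl) d phi * phi t = 0.
Proof.
move=> Cs; pose L := MxRepresentation left_regular_repr.
have ps : #[s].-primitive_root (w ^+ (N %/ #[s])).
  by rewrite dvdn_prim_root ?(order_dvd_N C_dv).
set z := w ^+ _ in ps.
have cGL : centgmx (regular_repr K C) (L s).
  apply/centgmxP=> x Cx; apply/row_matrixP=> i.
  rewrite !row_mul !rowK -!rowE !rowK !gring_indexK ?groupM ?groupV ?enum_valP //.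
  by rewrite mulgA.
have [S [SI SE]] := p_regular_trace_twist p_prime sysOKk pw C_dv ps cGL
  (repr_mx_order L Cs).
pose d phi := \sum_(i < #[s]) z ^+ i * (count_mem phi (S i))%:R.
pose T t := [set i : 'I_#|C| | (s^-1 * (enum_val i * t))%g == enum_val i].
have dE t : t \in C -> p^'.-elt t -> \sum_(phi <- bl) d phi * phi t = #|T t|%:R.
  move=> Ct p't; transitivity (\tr (regular_repr K C t *m L s)).
    rewrite SE //.
    under [RHS]eq_bigr => i _ do rewrite (sum_count_IBr _ (SI i)) mulr_sumr.
    rewrite exchange_big /=; apply: eq_bigr => phi _.
    by rewrite mulr_suml; apply: eq_bigr => i _; rewrite mulrA.
  rewrite /mxtrace -(sum1_card (mem (T t))) natr_sum [RHS]big_mkcond /=.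
  apply: eq_bigr => i _.
  have <- : row i (regular_repr K C t *m L s) 0 i = (regular_repr K C t *m L s) i i.
    by rewrite mxE.
  rewrite row_mul !rowK -!rowE !rowK !gring_indexK ?groupM ?groupV ?enum_valP //.
  rewrite mxE /= inE -(inj_eq enum_val_inj) gring_indexK ?groupM ?groupV ?enum_valP //.
  by rewrite eq_sym; case: (_ == _).
exists d => [p's|t Ct p't nst]; rewrite dE //.
  rewrite (proj1 (pcharf0P K) (pmod_char_frac sysOKk)) -lt0n card_gt0.
  apply/set0Pn; exists (gring_index C 1%g).
  by rewrite inE gring_indexK // mul1g mulVg.
rewrite (_ : T t = finset.set0) ?cards0 //; apply/setP=> i; rewrite !inE.
apply: contraNF nst => /eqP Di; apply/imsetP; exists (enum_val i).
  exact: enum_valP.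
by rewrite conjgE -{2}Di mulKVg mulKg.
Qed.

Lemma IBr_free (c : {ffun gT -> K} -> K) :
    (forall s, s \in C -> p^'.-elt s -> \sum_(phi <- bl) c phi * phi s = 0) ->
  forall phi, phi \in bl -> c phi = 0.
Proof.
move=> c0; pose cls := p_regular_classes p C.
pose rep (j : 'I_#|cls|) := repr (enum_val j).
have repP j : [/\ rep j \in C, p^'.-elt (rep j) & enum_val j = (rep j ^: C)%g].
  have := enum_valP j; rewrite inE => /andP[/repr_classesP[Cj Dj] p'j].
  by split.
pose Phi : 'M[K]_(size bl, #|cls|) := \matrix_(i, j) (bl`_i) (rep j).
have fullPhi : row_full Phi.
  rewrite -sub1mx; apply/row_subP=> j; rewrite row1.
  have [Cj p'j clj] := repP j; have [d /(_ p'j) nzd d0] := class_separation Cj.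
  apply/submxP; pose a := \sum_(phi <- bl) d phi * phi (rep j).
  exists (\row_i (a^-1 * d bl`_i)); apply/rowP=> l; rewrite !mxE.
  rewrite (eq_bigr (fun i : 'I_(size bl) => a^-1 * (d bl`_i * (bl`_i) (rep l)))).
    rewrite -mulr_sumr.
    have -> : \sum_(i < size bl) d bl`_i * (bl`_i) (rep l) =
        \sum_(phi <- bl) d phi * phi (rep l) by rewrite [RHS](big_nth 0) big_mkord.
    have [->|njl] := eqVneq l j; first by rewrite eqxx mulVf.
    have [Cl p'l cll] := repP l; rewrite d0 ?mulr0 1?eq_sym ?(negPf njl) //.
    apply: contra njl => /class_eqP; rewrite -cll -clj => /enum_val_inj->.
    exact: eqxx.
  by move=> i _; rewrite !mxE mulrA.
have freePhi : row_free Phi.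
  by rewrite /row_free eqn_leq rank_leq_row (eqP fullPhi) size_IBr_leq // => phi /blP.
move=> phi bl_phi; have /(nthP 0)[i lt_i <-] := bl_phi.
suff: \row_(i < size bl) c bl`_i = 0 by move/rowP/(_ (Ordinal lt_i)); rewrite !mxE.
apply: (row_free_inj freePhi); rewrite mul0mx; apply/rowP=> j; rewrite !mxE.
have [Cj p'j _] := repP j; rewrite -[RHS](c0 _ Cj p'j) (big_nth 0) big_mkord.
by apply: eq_bigr => l _; rewrite !mxE.
Qed.

End BrauerIndependence.

(** * Generalised decomposition numbers *)

Section InQw.

Variables (K : fieldType) (K0 : [pchar K] =i pred0) (w : K).

Lemma inQw0 : inQw w 0. Proof. by exists 0; rewrite (qeval0 K0). Qed.
Lemma inQw1 : inQw w 1. Proof. by exists 1; rewrite (qeval1 K0). Qed.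
Lemma inQwX i : inQw w (w ^+ i). Proof. by exists 'X^i; rewrite (qevalXn K0). Qed.
Lemma inQwD x y : inQw w x -> inQw w y -> inQw w (x + y).
Proof. by move=> [f ->] [g ->]; exists (f + g); rewrite (qevalD K0). Qed.
Lemma inQwB x y : inQw w x -> inQw w y -> inQw w (x - y).
Proof. by move=> [f ->] [g ->]; exists (f - g); rewrite (qevalB K0). Qed.
Lemma inQwM x y : inQw w x -> inQw w y -> inQw w (x * y).
Proof. by move=> [f ->] [g ->]; exists (f * g); rewrite (qevalM K0). Qed.
Lemma inQw_nat n : inQw w n%:R.
Proof.
elim: n => [|n IHn]; first exact: inQw0.
by rewrite -addn1 natrD; apply/inQwD/inQw1.
Qed.
Lemma inQw_sum (I : Type) (r : seq I) (P : pred I) F :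
  (forall i, P i -> inQw w (F i)) -> inQw w (\sum_(i <- r | P i) F i).
Proof. by move=> FQ; elim/big_ind: _ => //; [apply: inQw0 | apply: inQwD]. Qed.

Lemma inQw_pow i x : inQw (w ^+ i) x -> inQw w x.
Proof. by case=> f ->; exists (f \Po 'X^i); rewrite (qevalXnM K0). Qed.

End InQw.

Section CycConj.

Variables (K : fieldType) (N : nat) (w : K).
Hypotheses (K0 : [pchar K] =i pred0) (pw : N.-primitive_root w).
Variable a : nat.
Hypothesis coaN : coprime a N.

Lemma cyc_conjD x y : inQw w x -> inQw w y ->
  cyc_conj w a (x + y) = cyc_conj w a x + cyc_conj w a y.
Proof.
by move=> [f ->] [g ->]; rewrite -(qevalD K0) !(cyc_conjE K0 pw) // (qevalD K0).
Qed.

Lemma cyc_conj_mul x y : inQw w x -> inQw w y ->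
  cyc_conj w a (x * y) = cyc_conj w a x * cyc_conj w a y.
Proof.
by move=> [f ->] [g ->]; rewrite -(qevalM K0) !(cyc_conjE K0 pw) // (qevalM K0).
Qed.

Lemma cyc_conj0 : cyc_conj w a 0 = 0.
Proof. by rewrite -(qeval0 K0 w) (cyc_conjE K0 pw) // !(qeval0 K0). Qed.

Lemma cyc_conj_sum (I : Type) (r : seq I) (P : pred I) F :
    (forall i, P i -> inQw w (F i)) ->
  cyc_conj w a (\sum_(i <- r | P i) F i) = \sum_(i <- r | P i) cyc_conj w a (F i).
Proof.
move=> FQ; elim: r => [|i r IHr]; first by rewrite !big_nil cyc_conj0.
rewrite !big_cons; case: ifP => // Pi.
by rewrite cyc_conjD ?IHr //; [apply: FQ | apply: inQw_sum].
Qed.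

(** An automorphism that fixes w^d fixes Q(w^d). *)
Lemma cyc_conj_id d x : (d %| N)%N -> a = 1 %[mod N %/ d] -> inQw (w ^+ d) x ->
  cyc_conj w a x = x.
Proof.
move=> d_dv a1 [f ->]; rewrite -(qevalXnM K0) (cyc_conjE K0 pw) // !(qevalXnM K0).
congr qeval; rewrite -exprM mulnC exprM; apply/eqP.
have N_gt0 := prim_order_gt0 pw.
have pd : (N %/ d).-primitive_root (w ^+ d).
  have := dvdn_prim_root pw (dvdn_div d_dv).
  by rewrite divnA // mulKn.
by rewrite -[X in _ == X]expr1 (eq_prim_root_expr pd) a1.
Qed.

End CycConj.

Section Decomposition.

Variables (p : nat) (O : idomainType) (K k : fieldType).
Variables (frac : {rmorphism O -> K}) (res : {rmorphism O -> k}).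
Hypothesis p_prime : prime p.
Hypothesis sysOKk : pmodular_system p frac res.
Variables (gT : finGroupType) (G : {group gT}) (w : K).
Hypothesis pw : #|G|.-primitive_root w.

Local Notation N := #|G|.
Let K0 : [pchar K] =i pred0 := pmod_char_frac sysOKk.

Lemma cent1_dvd u : (#|'C_G[u]%G| %| #|G|)%N.
Proof. exact: cardSg (subsetIl _ _). Qed.

Lemma IBr_value_inQw (C : {group gT}) phi s : C \subset G -> IBr p frac res C phi ->
  p^'.-elt s -> inQw (w ^+ N`_p) (phi s).
Proof.
move=> sCG [n [rG [_ rG_phi]]] p's; have := rG_phi s.
rewrite p's andbT; case: ifP => [Cs [zs [zsm _ ->]]|_ ->]; last exact: inQw0.
rewrite big_seq; apply: inQw_sum => // z /zsm /(congr1 frac).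
rewrite rmorphXn rmorph1 => zm.
have pw' : (N`_p^')%N.-primitive_root (w ^+ N`_p).
  have := dvdn_prim_root pw (dvdn_part p^' #|G|).
  by rewrite -{2}(partnC p (cardG_gt0 G)) mulnK ?part_gt0.
have zm' : frac z ^+ N`_p^' = 1.
  have /dvdnP[e ->] : (#[s] %| N`_p^')%N.
    rewrite -(part_pnat_id p's) partn_dvd ?cardG_gt0 //.
    exact: (order_dvdG (fintype.subsetP sCG _ Cs)).
  by rewrite mulnC exprM zm expr1n.
by have [i ->] := prim_rootP pw' zm'; apply: inQwX.
Qed.

(** chi has generalised decomposition numbers d at u with respect to the list
    bl of Brauer characters of the centraliser, with values in Q(w^(N_p')). *)
Definition decomposes (bl : seq {ffun gT -> K}) (chi : {ffun gT -> K}) u :=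
  exists d : {ffun gT -> K} -> K, (forall phi, inQw (w ^+ N`_p^') (d phi)) /\
    forall s, s \in 'C_G[u] -> p^'.-elt s ->
      chi (u * s)%g = \sum_(phi <- bl) d phi * phi s.

Variables (u : gT) (bl : seq {ffun gT -> K}).
Hypotheses (Gu : u \in G) (pu : p.-elt u).
Hypotheses (Ubl : uniq bl) (blP : forall phi, IBr p frac res 'C_G[u] phi <-> phi \in bl).

Lemma decomposes0 : decomposes bl 0 u.
Proof.
exists (fun=> 0); split=> [phi|s _ _]; first exact: inQw0.
by rewrite ffunE big1 // => phi _; rewrite mul0r.
Qed.

Lemma decomposesD chi1 chi2 :
  decomposes bl chi1 u -> decomposes bl chi2 u -> decomposes bl (chi1 + chi2) u.
Proof.
move=> [d1 [d1Q D1]] [d2 [d2Q D2]]; exists (fun phi => d1 phi + d2 phi).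
split=> [phi|s Cs p's]; first exact: inQwD.
rewrite ffunE D1 // D2 // -big_split; apply: eq_bigr => phi _ /=.
by rewrite mulrDl.
Qed.

Lemma decomposesB chi1 chi2 :
  decomposes bl chi1 u -> decomposes bl chi2 u -> decomposes bl (chi1 - chi2) u.
Proof.
move=> [d1 [d1Q D1]] [d2 [d2Q D2]]; exists (fun phi => d1 phi - d2 phi).
split=> [phi|s Cs p's]; first exact: inQwB.
rewrite !ffunE D1 // D2 // -sumrB; apply: eq_bigr => phi _ /=.
by rewrite mulrBl.
Qed.

Lemma decomposes_repr n (rG : mx_representation K G n) :
  decomposes bl (char_of_repr rG) u.
Proof.
have sCG : 'C_G[u] \subset G by apply: subsetIl.
pose rC := subg_repr rG sCG.
have Cu : u \in 'C_G[u] by rewrite inE Gu cent1id.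
have cGu : centgmx rC (rG u).
  apply/centgmxP=> x /setIP[Gx /cent1P cux]; rewrite /= -!repr_mxM //.
  by rewrite cux.
have u_dv : (#[u] %| N`_p)%N.
  by rewrite -(part_pnat_id pu) partn_dvd ?cardG_gt0 ?order_dvdG.
pose v := w ^+ N`_p^'.
have pv : (N`_p)%N.-primitive_root v.
  have := dvdn_prim_root pw (dvdn_part p #|G|).
  by rewrite -{2}(partnC p (cardG_gt0 G)) mulKn ?part_gt0.
have pz : #[u].-primitive_root (v ^+ (N`_p %/ #[u])) by apply: dvdn_prim_root.
have [S [SI SE]] := p_regular_trace_twist p_prime sysOKk pw (cent1_dvd u) pz cGu
  (repr_mx_order rG Gu).
set z := v ^+ _ in SE.
exists (fun phi => \sum_(i < #[u]) z ^+ i * (count_mem phi (S i))%:R).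
split=> [phi|s Cs p's].
  apply: inQw_sum => // i _; apply: inQwM => //; last exact: inQw_nat.
  by rewrite /z -exprM; apply: inQwX.
have Gs : s \in G by apply: (fintype.subsetP sCG _ Cs).
rewrite ffunE groupM // repr_mxM // mxtrace_mulC.
rewrite (SE s Cs p's).
under eq_bigr => i _ do rewrite (sum_count_IBr Ubl blP _ (SI i)) mulr_sumr.
rewrite exchange_big /=; apply: eq_bigr => phi _.
by rewrite mulr_suml; apply: eq_bigr => i _; rewrite mulrA.
Qed.

Lemma decomposes_ZIrr chi : ZIrr G chi -> decomposes bl chi u.
Proof.
case=> a ->; case: finite_supportP => [_|X sXI _ _].
  by rewrite big_nil; apply: decomposes0.
rewrite big_seq; apply: (big_ind (fun f => decomposes bl f u)).
- exact: decomposes0.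
- exact: decomposesD.
move=> psi /sXI[n [rG [_ ->]]].
have nat_mul m : decomposes bl (char_of_repr rG *+ m) u.
  elim: m => [|m IHm]; first by rewrite mulr0n; apply: decomposes0.
  by rewrite mulrS; apply: decomposesD => //; apply: decomposes_repr.
case: (a _) => m; first exact: nat_mul.
rewrite NegzE mulrNz -[- _]add0r; apply: decomposesB; first exact: decomposes0.
exact: nat_mul.
Qed.

(** By independence of Brauer characters, the chosen generalised decomposition
    numbers agree with the ones constructed above. *)
Lemma gen_decomp_numP chi : ZIrr G chi ->
  (forall phi, phi \in bl ->
     inQw (w ^+ N`_p^') (gen_decomp_num p frac res G chi u phi)) /\
  forall s, s \in 'C_G[u] -> p^'.-elt s -> chi (u * s)%g =
    \sum_(phi <- bl) gen_decomp_num p frac res G chi u phi * phi s.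
Proof.
move=> chi_gen; have [d [dQ dE]] := decomposes_ZIrr chi_gen.
have sum_IBr (c : {ffun gT -> K} -> K) s :
    \sum_(phi \in IBr p frac res 'C_G[u]) c phi * phi s
      = \sum_(phi <- bl) c phi * phi s.
  rewrite [RHS]fsbig_seq //; apply: eq_fsbigl.
  by apply/seteqP; split=> phi /blP.
have d'E : gen_decomposition p frac res G chi u (gen_decomp_num p frac res G chi u).
  by apply: xgetPex; exists d => s Cs p's; rewrite sum_IBr dE.
set d' := gen_decomp_num _ _ _ _ _ _ in d'E *.
split=> [phi bl_phi|s Cs p's]; last by rewrite d'E // sum_IBr.
suff -> : d' phi = d phi by [].
apply/eqP; rewrite -subr_eq0; apply/eqP.
apply: (IBr_free p_prime sysOKk pw (cent1_dvd u) Ubl blP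
  (c := fun phi => d' phi - d phi)) bl_phi => s Cs p's.
under eq_bigr do rewrite mulrBl.
by rewrite sumrB -dE // d'E // sum_IBr subrr.
Qed.

End Decomposition.

Theorem theorem1p1 (p : nat) (O : idomainType) (K k : fieldType)
    (frac : {rmorphism O -> K}) (res : {rmorphism O -> k})
    (p_prime : prime p) (sysOKk : pmodular_system p frac res)
    (gT : finGroupType) (G : {group gT})
    (K_large : exists w : K, #|G|.-primitive_root w)
    (chi : {ffun gT -> K}) (chi_gen : ZIrr G chi) :
  ((char_conductor G chi)`_p)%N
    = conductor (gen_decomp_nums p frac res G chi).
Proof.
have [w pw] := K_large; have K0 := pmod_char_frac sysOKk.
have /choice[bl blP] u : exists bl : seq {ffun gT -> K}, uniq bl /\
    forall phi, IBr p frac res 'C_G[u] phi <-> phi \in bl.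
  have [bl Ubl blP] := IBr_enumeration p_prime sysOKk pw (cent1_dvd G u).
  by exists bl.
pose d u := gen_decomp_num p frac res G chi u.
have dP u (Gu : u \in G) (pu : p.-elt u) :=
  gen_decomp_numP p_prime sysOKk pw Gu pu (blP u).1 (blP u).2 chi_gen.
have phiQ u phi s : phi \in bl u -> p^'.-elt s -> inQw (w ^+ #|G| `_p) (phi s).
  by move=> /(blP u).2; apply: IBr_value_inQw => //; apply: subsetIl.
have dQ u phi : u \in G -> p.-elt u -> phi \in bl u -> inQw w (d u phi).
  by move=> Gu pu bl_phi; apply/(inQw_pow K0)/(dP u Gu pu).1.
have chiE g : g \in G -> [/\ g.`_p \in G, p.-elt g.`_p, g.`_p^' \in 'C_G[g.`_p],
    p^'.-elt g.`_p^' & g = g.`_p * g.`_p^']%g.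
  move=> Gg; have Gp pi : g.`_pi%g \in G by apply: groupX.
  split; rewrite ?Gp ?p_elt_constt ?consttC //.
  rewrite inE Gp /=; apply/cent1P; apply: commuteX2.
  exact: commute_refl.
apply: (conductor_p_part K0 pw).
- move=> x [g Gg ->]; have [Gu pu Cs p's ->] := chiE g Gg.
  rewrite (dP _ Gu pu).2 // big_seq; apply: inQw_sum => // phi bl_phi.
  by apply: inQwM => //; [apply: dQ | apply/(inQw_pow K0)/phiQ/p's/bl_phi].
- by move=> x [u [phi [Gu pu /(blP u).2 bl_phi ->]]]; apply: (dP u Gu pu).1.
move=> a coa a1.
have conj_phi u phi s : phi \in bl u -> p^'.-elt s -> cyc_conj w a (phi s) = phi s.
  move=> bl_phi p's; apply: (cyc_conj_id K0 pw coa _ _ (phiQ u _ _ bl_phi p's)).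
    exact: dvdn_part.
  have -> // : (#|G| %/ #|G| `_p)%N = (#|G| `_p^')%N.
  by rewrite -{1}(partnC p (cardG_gt0 G)) mulKn ?part_gt0.
have conj_chi u s : u \in G -> p.-elt u -> s \in 'C_G[u] -> p^'.-elt s ->
    cyc_conj w a (chi (u * s)%g) = \sum_(phi <- bl u) cyc_conj w a (d u phi) * phi s.
  move=> Gu pu Cs p's; rewrite (dP u Gu pu).2 //.
  have -> : \sum_(phi <- bl u) d u phi * phi s =
      \sum_(phi <- bl u | phi \in bl u) d u phi * phi s by rewrite -big_seq.
  rewrite (cyc_conj_sum K0 pw) // => [|phi bl_phi]; last first.
    by apply: inQwM => //; [apply: dQ | apply/(inQw_pow K0)/phiQ/p's/bl_phi].
  rewrite [RHS]big_seq; apply: eq_bigr => phi bl_phi.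
  rewrite (cyc_conj_mul K0 pw) ?(conj_phi _ _ _ bl_phi) //; first exact: dQ.
  exact/(inQw_pow K0)/phiQ/p's/bl_phi.
split=> [fix_chi x [u [phi [Gu pu /(blP u).2 bl_phi ->]]] | fix_d x [g Gg ->]].
  apply/eqP; rewrite -subr_eq0; apply/eqP.
  apply: (IBr_free p_prime sysOKk pw (cent1_dvd G u) (blP u).1 (blP u).2
    (c := fun phi => cyc_conj w a (d u phi) - d u phi)) bl_phi => s Cs p's.
  under eq_bigr do rewrite mulrBl.
  rewrite sumrB -conj_chi // -(dP u Gu pu).2 // fix_chi ?subrr //.
  by exists (u * s)%g; rewrite ?groupM //; case/setIP: Cs.
have [Gu pu Cs p's ->] := chiE g Gg; rewrite conj_chi // (dP _ Gu pu).2 //.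
apply: eq_big_seq => phi bl_phi; congr (_ * _); apply: fix_d.
by exists g.`_p%g, phi; split=> //; apply/(blP _).2.
Qed.
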